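(* Assume $\Bbbk$ is algebraically closed, let $a\in\mathbb{Z}$, and let $M$ be any graded $S$-module with minimal free resolution $\mathbf{F}$. If $$\operatorname{Ext}^i_S(M,M)_{a-ia} = 0$$ for all integers $i$ with $2\leq i\leq\operatorname{pdim}(M)$, then every degree $a$ differential module with homology $M$ is quasi-isomorphic to $\operatorname{Fold}^a(\mathbf{F})$ (in other words, $M$ is $a$-rigid).
   Context: $S$ is a Noetherian graded-local ring: an $\mathbb{N}$-graded ring (possibly concentrated in degree $0$) whose degree $0$ component is local, with residue field $\Bbbk$. All modules are finitely generated; $\operatorname{pdim}$ is projective dimension. A differential module $(D,d)$ is an $S$-module $D$ with an $S$-endomorphism $d$ such that $d^2=0$. It is of degree $a$ if $D$ is graded and $d\colon D\to D(a)$ is a graded map; its homology is $H(D)=\ker(d)/\operatorname{im}(d(-a))$. Morphisms are graded $S$-module maps commuting with the endomorphisms, and a quasi-isomorphism is a morphism inducing an isomorphism on homology. For a homogeneous complex $(C_\bullet,\partial)$ (differentials of degree $0$), $\operatorname{Fold}^a(C_\bullet)$ is the degree $a$ differential module $(\bigoplus_i C_i(ia),\partial)$. A free flag is a differential module $D$ with a splitting $D=\bigoplus_{i\in\mathbb{Z}}G_i$, each $G_i$ free, $G_i=0$ for $i<0$, and $d(G_i)\subseteq\bigoplus_{j<i}G_j$; its anchor is the complex with terms $G_i$ and differentials $G_i\to G_{i-1}$ the components of $d$. A degree $a$ free flag is anchored on a homogeneous complex $\mathbf{F}$ if it has underlying module $\bigoplus_i F_i(ia)$ and the anchor is $\mathbf{F}$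 with $F_i$ twisted by $ia$. A homogeneous complex $\mathbf{F}$ of free modules is $a$-rigid if every degree $a$ free flag anchored on $\mathbf{F}$ is isomorphic to $\operatorname{Fold}^a(\mathbf{F})$; a graded module is $a$-rigid if some (equivalently every) homogeneous free resolution of it is $a$-rigid. *)

(* Defs.v *)
From HB Require Import structures.
From mathcomp Require Import all_boot all_order all_algebra.
From mathcomp Require Import boolp classical_sets functions.
From Stdlib Require Import Relation_Operators.

Set Implicit Arguments.
Unset Strict Implicit.
Unset Printing Implicit Defensive.

Import GRing.Theory.
Local Open Scope ring_scope.
Local Open Scope quotient_scope.

Section SubQuotient.
Variables (R : comNzRingType) (V : lmodType R) (N : submodClosed V).

Record submod_type := SubMod { submod_val : V; submod_valP : submod_val \in N }.
HB.instance Definition _ := [isSub for submod_val].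
HB.instance Definition _ := [Choice of submod_type by <:].
HB.instance Definition _ := [SubChoice_isSubLmodule of submod_type by <:].

Definition quot_pred : {pred V} := fun x => x \in N.
Lemma quot_pred_closed : zmod_closed quot_pred.
Proof.
split=> [|x y Nx Ny]; first exact: (rpred0 N).
by apply: (rpredD (S := N)) => //; rewrite -scaleN1r; apply: (rpredZ (s := N)).
Qed.
HB.instance Definition _ := GRing.isZmodClosed.Build V quot_pred quot_pred_closed.

Definition quot_type := Quotient.quot quot_pred.
HB.instance Definition _ := GRing.Zmodule.on quot_type.

Definition quot_pi (x : V) : quot_type := \pi_(Quotient.quot quot_pred) x.

Lemma quot_pi_eq x y : quot_pi x = quot_pi y <-> x - y \in N.
Proof.
have -> : (x - y \in N) = (x - y \in quot_pred) by [].
by rewrite Quotient.idealrBE; split=> /eqP.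
Qed.

Lemma quot_pi_surj (q : quot_type) : exists x, quot_pi x = q.
Proof. by exists (repr (q : Quotient.quot quot_pred)); rewrite /quot_pi reprK. Qed.

Lemma quot_pi_additive : zmod_morphism quot_pi.
Proof. by move=> x y; rewrite /quot_pi raddfB. Qed.

Definition quot_scale (c : R) (q : quot_type) : quot_type :=
  quot_pi (c *: repr (q : Quotient.quot quot_pred)).

Lemma quot_scale_pi c x : quot_scale c (quot_pi x) = quot_pi (c *: x).
Proof.
apply/quot_pi_eq; rewrite -scalerBr; apply: rpredZ.
by apply/quot_pi_eq; rewrite /quot_pi reprK.
Qed.

Let pi_add x y : quot_pi x + quot_pi y = quot_pi (x + y).
Proof. by rewrite /quot_pi raddfD. Qed.

Let scaleA c c' q : quot_scale c (quot_scale c' q) = quot_scale (c * c') q.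
Proof. by have [x <-] := quot_pi_surj q; rewrite !quot_scale_pi scalerA. Qed.
Let scale1 : left_id 1 quot_scale.
Proof. by move=> q; have [x <-] := quot_pi_surj q; rewrite quot_scale_pi scale1r. Qed.
Let scaleDr : right_distributive quot_scale +%R.
Proof.
move=> c q q'; have [x <-] := quot_pi_surj q; have [y <-] := quot_pi_surj q'.
by rewrite pi_add !quot_scale_pi pi_add scalerDr.
Qed.
Let scaleDl q : {morph quot_scale^~ q : c c' / c + c'}.
Proof.
move=> c c'; have [x <-] := quot_pi_surj q.
by rewrite !quot_scale_pi pi_add scalerDl.
Qed.

HB.instance Definition _ :=
  GRing.Zmodule_isLmodule.Build R quot_type scaleA scale1 scaleDr scaleDl.

Lemma quot_pi_linear : linear quot_pi.
Proof.
by move=> c x y; rewrite -pi_add; congr (_ + _); rewrite -quot_scale_pi.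
Qed.
HB.instance Definition _ :=
  GRing.isLinear.Build R V quot_type *:%R quot_pi quot_pi_linear.

End SubQuotient.

Section Homology.
Variable R : comNzRingType.

Section Kernel.
Variables (V W : lmodType R) (g : {linear V -> W}).
Definition ker_pred : {pred V} := fun x => g x == 0.
Lemma ker_predE x : (x \in ker_pred) = (g x == 0). Proof. by []. Qed.
Lemma ker_pred_closed : subsemimod_closed ker_pred.
Proof.
apply: GRing.submod_closed_semi.
split=> [|c u v]; rewrite !ker_predE ?linear0 // => /eqP u0 /eqP v0.
by rewrite linearP u0 v0 scaler0 addr0.
Qed.
HB.instance Definition _ := GRing.isSubmodClosed.Build R V ker_pred ker_pred_closed.
Definition ker_type : lmodType R := submod_type ker_pred.
Definition ker_val (z : ker_type) : V := submod_val z.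
Lemma ker_val_linear : linear ker_val. Proof. by []. Qed.
HB.instance Definition _ :=
  GRing.isLinear.Build R ker_type V *:%R ker_val ker_val_linear.
Lemma ker_valP (z : ker_type) : g (ker_val z) = 0.
Proof. by apply/eqP; exact: (submod_valP z). Qed.
Lemma ker_val_inj : injective ker_val.
Proof. exact: val_inj. Qed.
Definition ker_mk (x : V) (gx : g x = 0) : ker_type :=
  @SubMod _ _ ker_pred x (introT eqP gx).
End Kernel.

Variables (U V W : lmodType R) (f : {linear U -> V}) (g : {linear V -> W}).

Definition im_pred : {pred ker_type g} :=
  fun z => `[< exists u, ker_val z = f u >].
Lemma im_predE z : (z \in im_pred) = `[< exists u, ker_val z = f u >].
Proof. by []. Qed.
Lemma im_pred_closed : subsemimod_closed im_pred.
Proof.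
apply: GRing.submod_closed_semi.
split=> [|c z z']; rewrite !im_predE.
  by apply/asboolP; exists 0; rewrite !linear0.
move=> /asboolP[u zu] /asboolP[u' zu']; apply/asboolP; exists (c *: u + u').
by rewrite (linearP f) -zu -zu'; exact: ker_val_linear.
Qed.
HB.instance Definition _ :=
  GRing.isSubmodClosed.Build R (ker_type g) im_pred im_pred_closed.

(* The homology at V of U -> V -> W; im f is intersected with ker g, so that
   [g \o f = 0] is not needed to form the quotient. *)
Definition homology : lmodType R := quot_type im_pred.
Definition hclass : ker_type g -> homology := @quot_pi R (ker_type g) im_pred.

Lemma hclass_eq z z' :
  hclass z = hclass z' <-> exists u, ker_val z - ker_val z' = f u.
Proof.
rewrite /hclass quot_pi_eq im_predE -linearB.
by split=> [/asboolP|h]; last exact/asboolP.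
Qed.

Lemma hclass_surj (q : homology) : exists z, hclass z = q.
Proof. exact: quot_pi_surj. Qed.

Lemma hclass_linear : linear hclass.
Proof. exact: quot_pi_linear. Qed.
HB.instance Definition _ :=
  GRing.isLinear.Build R (ker_type g) homology *:%R hclass hclass_linear.

End Homology.
Arguments hclass {R U V W} f g _.
Arguments ker_val {R V W} g _.

Definition direct_sum_decomp (I : choiceType) (V : zmodType)
    (A : I -> V -> Prop) : Prop :=
  [/\ forall i, A i 0 /\ (forall x y, A i x -> A i y -> A i (x - y)),
      forall x, exists2 s : seq V,
        (forall y, y \in s -> exists i, A i y) & x = \sum_(y <- s) y
    & forall (s : seq I) (c : I -> V), uniq s -> (forall i, A i (c i)) ->
        \sum_(i <- s) c i = 0 -> forall i, i \in s -> c i = 0].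

Record gradedRing := GradedRing {
  gring :> comNzRingType;
  rgr : nat -> gring -> Prop;
  rgr_dec : direct_sum_decomp rgr;
  rgr_one : rgr 0 1;
  rgr_mul : forall m n x y, rgr m x -> rgr n y -> rgr (m + n) (x * y) }.

Section DegreeZero.
Variable S : gradedRing.
Definition deg0_pred : {pred S} := fun x => `[< rgr 0 x >].
Lemma deg0_predP x : reflect (rgr 0 x) (x \in deg0_pred).
Proof. exact: asboolP. Qed.
Lemma deg0_pred_closed : subring_closed deg0_pred.
Proof.
have [/(_ 0%N)[_ B] _ _] := rgr_dec S.
split=> [|x y /deg0_predP hx /deg0_predP hy|x y /deg0_predP hx /deg0_predP hy].
- by apply/deg0_predP; exact: rgr_one.
- by apply/deg0_predP; exact: B.
- by apply/deg0_predP; exact: (rgr_mul hx hy).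
Qed.
HB.instance Definition _ :=
  GRing.isSubringClosed.Build S deg0_pred deg0_pred_closed.
Record deg0_ring := Deg0 { deg0_val : S; deg0_valP : deg0_val \in deg0_pred }.
HB.instance Definition _ := [isSub for deg0_val].
HB.instance Definition _ := [Choice of deg0_ring by <:].
HB.instance Definition _ := [SubChoice_isSubComNzRing of deg0_ring by <:].
End DegreeZero.

Definition noetherian (R : comNzRingType) : Prop :=
  forall J : R -> Prop,
    J 0 -> (forall c x y, J x -> J y -> J (c * x + y)) ->
    exists n (g : 'I_n -> R),
      forall x, J x <-> exists c : 'I_n -> R, x = \sum_(i < n) c i * g i.

(* [idealr R] is the type of proper ideals of a commutative ring R. *)
Definition maximal_ideal (R : comNzRingType) (m : idealr R) : Prop :=
  forall J : idealr R, {subset m <= J} -> J =i m.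

Definition local_ring (R : comNzRingType) (m : idealr R) : Prop :=
  maximal_ideal m /\ forall m' : idealr R, maximal_ideal m' -> m' =i m.

(* The homogeneous maximal ideal m0 + S_+ of S. *)
Definition hom_max_ideal (S : gradedRing) (m0 : idealr (deg0_ring S)) (x : S)
    : Prop :=
  exists (u : deg0_ring S) (n : nat) (p : 'I_n -> S),
    [/\ u \in m0, forall i : 'I_n, rgr i.+1 (p i)
      & x = val u + \sum_(i < n) p i].

Record grModule (S : gradedRing) := GrModule {
  gmod :> lmodType S;
  gr : int -> gmod -> Prop;
  gr_dec : direct_sum_decomp gr;
  gr_scale : forall n j (c : S) x, rgr n c -> gr j x -> gr (n%:Z + j) (c *: x) }.
Arguments gr {S} _ _ _.

Section GradedModules.
Variable S : gradedRing.
Implicit Types M N : grModule S.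

Definition graded_map M N (f : M -> N) : Prop :=
  forall j x, gr M j x -> gr N j (f x).

Definition gr_iso M N : Prop :=
  exists (f : {linear M -> N}) (g : {linear N -> M}),
    [/\ graded_map f, graded_map g, cancel f g & cancel g f].

Definition fin_gen (V : lmodType S) : Prop :=
  exists n (e : 'I_n -> V),
    forall x, exists c : 'I_n -> S, x = \sum_(i < n) c i *: e i.

(* Finitely generated graded free modules: finite direct sums of S(-b). *)
Definition gr_free M : Prop :=
  exists n (b : 'I_n -> int) (e : 'I_n -> M),
    (forall i, gr M (b i) (e i)) /\
    (forall x, exists! c : {ffun 'I_n -> S}, x = \sum_(i < n) c i *: e i).

End GradedModules.

Section DirectSumLemmas.

Lemma big_uniq_sub (I : eqType) (V : nmodType) (s u : seq I) (F : I -> V) :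
  uniq s -> uniq u -> {subset s <= u} ->
  (forall i, i \in u -> i \notin s -> F i = 0) ->
  \sum_(i <- u) F i = \sum_(i <- s) F i.
Proof.
move=> us uu su F0; rewrite (bigID (mem s)) /= [X in _ + X]big1_seq ?addr0.
  rewrite -big_filter; apply: perm_big; apply: uniq_perm => //.
    exact: filter_uniq.
  move=> i; rewrite mem_filter /=; case si: (i \in s) => //=.
  by rewrite su.
by move=> i /andP[ni iu]; exact: F0.
Qed.

Variables (I : choiceType) (V : zmodType) (A : I -> V -> Prop).
Hypothesis decA : direct_sum_decomp A.

Lemma dsd0 i : A i 0. Proof. by case: decA => /(_ i)[]. Qed.
Lemma dsdB i x y : A i x -> A i y -> A i (x - y).
Proof. by case: decA => /(_ i)[_ h] _ _; exact: h. Qed.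
Lemma dsdN i x : A i x -> A i (- x).
Proof. by move=> h; rewrite -sub0r; apply: dsdB => //; exact: dsd0. Qed.
Lemma dsdD i x y : A i x -> A i y -> A i (x + y).
Proof. by move=> hx hy; rewrite -[y]opprK; apply: dsdB => //; exact: dsdN. Qed.

Lemma dsd_indep (s : seq I) (c : I -> V) : uniq s -> (forall i, A i (c i)) ->
  \sum_(i <- s) c i = 0 -> forall i, i \in s -> c i = 0.
Proof. by case: decA => _ _; exact. Qed.

Lemma dsd_comp x : exists (s : seq I) (c : I -> V),
  [/\ uniq s, forall i, A i (c i), forall i, i \notin s -> c i = 0
    & x = \sum_(i <- s) c i].
Proof.
case: decA => _ /(_ x)[r hr ->] _; elim: r hr => [|y r IH] hr.
  by exists [::], (fun=> 0); rewrite !big_nil; split=> // i; exact: dsd0.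
have [|s [c [us hc c0 e]]] := IH.
  by move=> z zr; apply: hr; rewrite inE zr orbT.
have [k hk] := hr y (mem_head _ _).
have [s' us' ms'] : exists2 s', uniq s' & s' =i k :: s.
  by exists (undup (k :: s)); [exact: undup_uniq|exact: mem_undup].
exists s', (fun i => (if i == k then y else 0) + c i); split=> //.
- by move=> i; apply: dsdD => //; case: eqP => [->|_] //; exact: dsd0.
- move=> i; rewrite ms' inE negb_or => /andP[/negbTE -> /c0 ->].
  by rewrite addr0.
rewrite big_cons e big_split /=; congr (_ + _).
  rewrite (@big_uniq_sub _ _ [:: k] s') //.
  + by rewrite big_seq1 eqxx.
  + by move=> i; rewrite inE => /eqP ->; rewrite ms' mem_head.
  + by move=> i _; rewrite inE => /negbTE ->.
rewrite (@big_uniq_sub _ _ s s') //.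
  by move=> i si; rewrite ms' inE si orbT.
by move=> i _; exact: c0.
Qed.

Lemma dsd_reindex (J : choiceType) (h : J -> I) (h' : I -> J) :
  cancel h h' -> cancel h' h -> direct_sum_decomp (fun j => A (h j)).
Proof.
move=> hK h'K; split=> [j|x|s c us hc s0 j sj].
- by split; [exact: dsd0|exact: dsdB].
- case: decA => _ /(_ x)[r hr e] _; exists r => // y /hr[i hi].
  by exists (h' i); rewrite h'K.
have := @dsd_indep [seq h j | j <- s] (fun i => c (h' i)).
rewrite (map_inj_uniq (can_inj hK)) big_map.
under eq_bigr do rewrite hK.
move=> /(_ us _ s0 (h j)); rewrite hK; apply.
  by move=> i; have := hc (h' i); rewrite h'K.
exact: map_f.
Qed.

End DirectSumLemmas.

Section Twist.
Variables (S : gradedRing) (M : grModule S) (a : int).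

Lemma twist_dec : direct_sum_decomp (fun j => gr M (a + j)).
Proof.
apply: (dsd_reindex (gr_dec M) (h' := fun i => i - a)) => j.
  by rewrite addrC addKr.
by rewrite addrC subrK.
Qed.

Lemma twist_scale n j (c : S) (x : M) :
  rgr n c -> gr M (a + j) x -> gr M (a + (n%:Z + j)) (c *: x).
Proof. by move=> hc hx; rewrite addrCA; exact: gr_scale. Qed.

(* M(a)_j = M_(a + j) *)
Definition twist : grModule S := GrModule twist_dec twist_scale.
End Twist.

Section DirectSum.
Variables (R : comNzRingType) (C : nat -> lmodType R).

Definition dprod : Type := forall i, C i.
HB.instance Definition _ := Choice.copy dprod (forall i, C i).

Let add (x y : dprod) : dprod := fun i => x i + y i.
Let opp (x : dprod) : dprod := fun i => - x i.
Let scale (c : R) (x : dprod) : dprod := fun i => c *: x i.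
Let addA : associative add.
Proof. by move=> x y z; apply: functional_extensionality_dep => i; exact: addrA. Qed.
Let addC : commutative add.
Proof. by move=> x y; apply: functional_extensionality_dep => i; exact: addrC. Qed.
Let add0 : left_id ((fun=> 0) : dprod) add.
Proof. by move=> x; apply: functional_extensionality_dep => i; exact: add0r. Qed.
Let addN : left_inverse ((fun=> 0) : dprod) opp add.
Proof. by move=> x; apply: functional_extensionality_dep => i; exact: addNr. Qed.
HB.instance Definition _ := GRing.isZmodule.Build dprod addA addC add0 addN.

Let scaleA c c' x : scale c (scale c' x) = scale (c * c') x.
Proof. by apply: functional_extensionality_dep => i; exact: scalerA. Qed.
Let scale1 : left_id 1 scale.
Proof. by move=> x; apply: functional_extensionality_dep => i; exact: scale1r. Qed.
Let scaleDr : right_distributive scale +%R.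
Proof. by move=> c x y; apply: functional_extensionality_dep => i; exact: scalerDr. Qed.
Let scaleDl x : {morph scale^~ x : c c' / c + c'}.
Proof. by move=> c c'; apply: functional_extensionality_dep => i; exact: scalerDl. Qed.
HB.instance Definition _ :=
  GRing.Zmodule_isLmodule.Build R dprod scaleA scale1 scaleDr scaleDl.

Definition finsupp_pred : {pred dprod} :=
  fun x => `[< exists n, forall i, (n <= i)%N -> x i = 0 >].
Lemma finsupp_predP x :
  reflect (exists n, forall i, (n <= i)%N -> x i = 0) (x \in finsupp_pred).
Proof. exact: asboolP. Qed.
Lemma finsupp_pred_closed : subsemimod_closed finsupp_pred.
Proof.
apply: GRing.submod_closed_semi.
split=> [|c x y /finsupp_predP[m hm] /finsupp_predP[n hn]].
  by apply/finsupp_predP; exists 0%N.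
apply/finsupp_predP; exists (maxn m n) => i; rewrite geq_max => /andP[mi ni].
rewrite [LHS](_ : _ = c *: x i + y i) //.
by rewrite hm // hn // scaler0 addr0.
Qed.
HB.instance Definition _ :=
  GRing.isSubmodClosed.Build R dprod finsupp_pred finsupp_pred_closed.

Definition dsum : lmodType R := submod_type finsupp_pred.
Definition dsum_coord (i : nat) (x : dsum) : C i := submod_val x i.

Lemma dsum_coord_linear i : linear (dsum_coord i).
Proof. by []. Qed.
HB.instance Definition _ i := GRing.isLinear.Build R dsum (C i) *:%R
  (dsum_coord i) (dsum_coord_linear i).

Lemma dsumP x y : (forall i, dsum_coord i x = dsum_coord i y) -> x = y.
Proof.
by move=> e; apply: val_inj; apply: functional_extensionality_dep; exact: e.
Qed.

Lemma dsum_finsupp x : exists n, forall i, (n <= i)%N -> dsum_coord i x = 0.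
Proof. exact/finsupp_predP/(submod_valP x). Qed.

Definition dsum_mk (x : dprod)
    (hx : exists n, forall i, (n <= i)%N -> x i = 0) : dsum :=
  @SubMod _ _ finsupp_pred x (introT (finsupp_predP x) hx).

Lemma dsum_inj_ex k (y : C k) : exists x : dsum,
  dsum_coord k x = y /\ forall i, i <> k -> dsum_coord i x = 0.
Proof.
pose f : dprod := fun i =>
  if pselect (k = i) is left e then eq_rect k C y i e else 0.
have hf : exists n, forall i, (n <= i)%N -> f i = 0.
  exists k.+1 => i ki; rewrite /f; case: pselect => // e.
  by rewrite -e ltnn in ki.
exists (dsum_mk hf); split=> [|i ik]; rewrite /dsum_coord /= /f.
  case: pselect => // e; have -> : e = erefl k by exact: Prop_irrelevance.
  by [].
by case: pselect => // e; case: ik.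
Qed.

End DirectSum.

Section GradedDirectSum.
Variables (S : gradedRing) (C : nat -> grModule S).

Definition gdsum_gr (j : int) (x : dsum C) : Prop :=
  forall i, gr (C i) j (dsum_coord i x).

Lemma gdsum_dec : direct_sum_decomp gdsum_gr.
Proof.
split=> [j|x|s c us hc s0 j sj].
- split=> [i|x y hx hy i]; first exact: (dsd0 (gr_dec (C i))).
  exact: (dsdB (gr_dec (C i)) (hx i) (hy i)).
- have [n hn] := dsum_finsupp x; elim: n x hn => [|n IH] x hn.
    exists [::] => //; rewrite big_nil; apply: dsumP => i.
    by rewrite hn.
  have [z [zn z0]] := @dsum_inj_ex S C n (dsum_coord n x).
  have [|r hr er] := IH (x - z).
    move=> i ni; rewrite (linearB (dsum_coord i)) /=.
    have [->|/eqP ik] := eqVneq i n; first by rewrite zn subrr.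
    by rewrite z0 // hn ?subr0 // ltn_neqAle eq_sym ni andbT; apply/eqP.
  have [s [c [us hc c0 ec]]] := dsd_comp (gr_dec (C n)) (dsum_coord n x).
  have [w hw] := choice (fun j => @dsum_inj_ex S C n (c j)).
  have ez : z = \sum_(j <- s) w j.
    apply: dsumP => i; rewrite (linear_sum (dsum_coord i)) /=.
    have [->|/eqP ik] := eqVneq i n.
      by rewrite zn ec; apply: eq_bigr => j _; have [-> _] := hw j.
    by rewrite z0 // big1 // => j _; have [_ ->] := hw j.
  exists (r ++ [seq w j | j <- s]); last first.
    by rewrite big_cat big_map /= -er -ez subrK.
  move=> y; rewrite mem_cat => /orP[/hr //|/mapP[j sj ->]]; exists j => i.
  have [wn w0] := hw j; have [->|/eqP ik] := eqVneq i n; first by rewrite wn.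
  by rewrite w0 //; exact: (dsd0 (gr_dec (C i))).
- apply: dsumP => i.
  apply: (dsd_indep (gr_dec (C i)) (c := fun j => dsum_coord i (c j)) us) => //.
  - by move=> k; exact: hc.
  - have := congr1 (@dsum_coord S C i) s0; rewrite linear_sum linear0; exact.

Qed.

Lemma gdsum_scale n j (c : S) x :
  rgr n c -> gdsum_gr j x -> gdsum_gr (n%:Z + j) (c *: x).
Proof. by move=> hc hx i; exact: (gr_scale hc (hx i)). Qed.

Definition gdsum : grModule S := GrModule gdsum_dec gdsum_scale.
End GradedDirectSum.

(* Homogeneous complexes concentrated in nonnegative homological degrees. *)
Record grComplex (S : gradedRing) := GrComplex {
  term :> nat -> grModule S;
  bd : forall i, {linear term i.+1 -> term i};
  bd_graded : forall i, graded_map (bd i);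
  bd_sq : forall i x, bd i (bd i.+1 x) = 0 }.
Arguments bd {S} _ _.

Definition free_resolution (S : gradedRing) (F : grComplex S) (M : grModule S)
    : Prop :=
  (forall i, gr_free (F i)) /\
  exists eps : {linear F 0%N -> M},
    [/\ graded_map eps, forall y, exists x, eps x = y,
        forall x, eps x = 0 <-> exists y, x = bd F 0 y
      & forall i x, bd F i x = 0 <-> exists y, x = bd F i.+1 y].

Definition minimal (S : gradedRing) (m0 : idealr (deg0_ring S))
    (F : grComplex S) : Prop :=
  forall i x, exists n (s : 'I_n -> S) (y : 'I_n -> F i),
    (forall k, hom_max_ideal m0 (s k)) /\ bd F i x = \sum_(k < n) s k *: y k.

Definition projective (R : comNzRingType) (P : lmodType R) : Prop :=
  forall (U V : lmodType R) (g : {linear U -> V}) (f : {linear P -> V}),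
    (forall y, exists x, g x = y) ->
    exists h : {linear P -> U}, forall x, g (h x) = f x.

(* There is a projective resolution 0 -> P_n -> ... -> P_0 -> M -> 0. *)
Definition proj_resolution_of_length (R : comNzRingType) (M : lmodType R)
    (n : nat) : Prop :=
  exists (P : nat -> lmodType R) (d : forall i, {linear P i.+1 -> P i})
         (eps : {linear P 0%N -> M}),
    [/\ forall i, projective (P i),
        forall i, (n < i)%N -> forall x : P i, x = 0,
        forall y, exists x, eps x = y,
        forall x, eps x = 0 <-> exists y, x = d 0%N y
      & forall i x, d i x = 0 <-> exists y, x = d i.+1 y].

(* i <= pdim M, where pdim M (possibly infinite) is the infimum of the lengths
   of the projective resolutions of M. *)
Definition le_pdim (R : comNzRingType) (i : nat) (M : lmodType R) : Prop :=
  forall n, proj_resolution_of_length M n -> (i <= n)%N.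

Section Hom.
Variable R : comNzRingType.

Section HomModule.
Variables U V : lmodType R.
Definition linear_pred : {pred U -> V} := fun f => `[< linear f >].
Lemma linear_predP f : reflect (linear f) (f \in linear_pred).
Proof. exact: asboolP. Qed.
Lemma linear_pred_closed : subsemimod_closed linear_pred.
Proof.
apply: GRing.submod_closed_semi.
split=> [|c f g /linear_predP hf /linear_predP hg]; apply/linear_predP => k x y.
  by rewrite /= scaler0 addr0.
rewrite [LHS](_ : _ = c *: f (k *: x + y) + g (k *: x + y)) //.
rewrite [RHS](_ : _ = k *: (c *: f x + g x) + (c *: f y + g y)) //.
by rewrite hf hg !scalerDr !scalerA [c * k]mulrC addrACA.
Qed.
HB.instance Definition _ :=
  GRing.isSubmodClosed.Build R (U -> V) linear_pred linear_pred_closed.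

Definition hom : lmodType R := submod_type linear_pred.
Definition hom_fun (f : hom) : U -> V := submod_val f.
Lemma hom_fun_linear (f : hom) : linear (hom_fun f).
Proof. exact/linear_predP/(submod_valP f). Qed.
HB.instance Definition _ (f : hom) :=
  GRing.isLinear.Build R U V *:%R (hom_fun f) (hom_fun_linear f).
Definition hom_mk (f : {linear U -> V}) : hom :=
  @SubMod _ _ linear_pred f (introT (linear_predP f) (linearP f)).
Lemma homP (f g : hom) : hom_fun f =1 hom_fun g -> f = g.
Proof. by move=> e; apply: val_inj; apply/funext. Qed.
End HomModule.

Variables (U V N : lmodType R) (h : {linear U -> V}).
Definition hom_precomp (f : hom V N) : hom U N :=
  hom_mk [the {linear U -> N} of hom_fun f \o h].
Lemma hom_precomp_linear : linear hom_precomp.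
Proof. by move=> c f g; apply: homP. Qed.
HB.instance Definition _ :=
  GRing.isLinear.Build R (hom V N) (hom U N) *:%R hom_precomp hom_precomp_linear.
End Hom.

Section Ext.
Variables (S : gradedRing) (F : grComplex S) (N : grModule S).

Definition cobd i : {linear hom (F i) N -> hom (F i.+1) N} :=
  @hom_precomp _ _ _ N (bd F i).
Definition cobd_in i : {linear hom (F i.-1) N -> hom (F i) N} :=
  match i return {linear hom (F i.-1) N -> hom (F i) N} with
  | 0%N => @GRing.null_fun _ _
  | i'.+1 => cobd i'
  end.

(* Ext^i_S(M, N), computed from a free resolution F of M. *)
Definition Ext (i : nat) : lmodType S := homology (cobd_in i) (cobd i).

(* The degree j component Ext^i_S(M, N)_j consists of the classes of cocycles
   F_i -> N of degree j; it is a grading since the F_i are finitely generated. *)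
Definition Ext_gr (i : nat) (j : int) (q : Ext i) : Prop :=
  exists2 z : ker_type (cobd i),
    forall k x, gr (F i) k x -> gr N (k + j) (hom_fun (ker_val _ z) x)
    & q = hclass (cobd_in i) (cobd i) z.
End Ext.

Record diffModule (S : gradedRing) (a : int) := DiffModule {
  dmod :> grModule S;
  diff : {linear dmod -> dmod};
  diff_graded : @graded_map S dmod (twist dmod a) diff;
  diff_sq : forall x, diff (diff x) = 0 }.
Arguments diff {S a} _.

Section DiffHomology.
Variables (S : gradedRing) (a : int) (D : diffModule S a).

Definition dh_gr (j : int) (q : homology (diff D) (diff D)) : Prop :=
  exists2 z : ker_type (diff D), gr D j (ker_val _ z) & q = hclass (diff D) (diff D) z.

Lemma ker_diff_comp z s (c : int -> D) :
  uniq s -> (forall j, gr D j (c j)) -> (forall j, j \notin s -> c j = 0) ->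
  z = \sum_(j <- s) c j -> diff D z = 0 -> forall j, diff D (c j) = 0.
Proof.
move=> us hc c0 -> dz j; have [sj|/c0 ->] := boolP (j \in s); last first.
  by rewrite linear0.
apply: (dsd_indep (twist_dec D a) (c := fun j => diff D (c j)) us) => //.
  by move=> k; exact: diff_graded.
by rewrite -linear_sum.
Qed.

Lemma dh_dec : direct_sum_decomp dh_gr.
Proof.
have A := gr_dec D; split=> [j|q|s q us hq s0 j sj].
- split=> [|x y [z hz ->] [w hw ->]].
    exists 0; last by rewrite (linear0 (hclass (diff D) (diff D))).
    by rewrite (linear0 (ker_val (diff D))); exact: dsd0 A j.
  exists (z - w); last by rewrite (linearB (hclass (diff D) (diff D))).
  by rewrite (linearB (ker_val (diff D))); exact: dsdB A _ _ _ hz hw.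
- have [z <-] := hclass_surj q.
  have [s [c [us hc c0 e]]] := dsd_comp A (ker_val _ z).
  have dc := ker_diff_comp us hc c0 e (ker_valP z).
  exists [seq hclass (diff D) (diff D) (ker_mk (dc j)) | j <- s].
    by move=> _ /mapP[j _ ->]; exists j; exists (ker_mk (dc j)).
  rewrite big_map -(linear_sum (hclass (diff D) (diff D))); congr hclass.
  by apply: ker_val_inj; rewrite (linear_sum (ker_val (diff D))).
have /choice[z hz] : forall k, exists w : ker_type (diff D),
    gr D k (ker_val _ w) /\ q k = hclass (diff D) (diff D) w.
  by move=> k; have [w] := hq k; exists w.
have : hclass (diff D) (diff D) (\sum_(k <- s) z k) = hclass (diff D) (diff D) 0.
  rewrite (linear_sum (hclass (diff D) (diff D))) (linear0 (hclass (diff D) (diff D))) -[RHS]s0.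
  by apply: eq_bigr => k _; have [_ ->] := hz k.
move=> /hclass_eq[w]; rewrite (linear0 (ker_val (diff D))) subr0.
rewrite (linear_sum (ker_val (diff D))).
have [t [c [ut hc c0 ->]]] := dsd_comp A w.
rewrite linear_sum /= => e.
have [u uu mu] : exists2 u, uniq u & u =i s ++ [seq a + k | k <- t].
  by exists (undup (s ++ [seq a + k | k <- t]));
     [exact: undup_uniq|exact: mem_undup].
pose f k := (if k \in s then ker_val _ (z k) else 0) - diff D (c (k - a)).
have e1 : \sum_(k <- u) (if k \in s then ker_val _ (z k) else 0) =
    \sum_(k <- s) ker_val _ (z k).
  rewrite (big_uniq_sub us uu).
  - by apply: eq_big_seq => k ->.
  - by move=> k ks; rewrite mu mem_cat ks.
  - by move=> k _ /negbTE ->.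
have e2 : \sum_(k <- u) diff D (c (k - a)) = \sum_(k <- t) diff D (c k).
  rewrite (@big_uniq_sub _ _ [seq a + k | k <- t] u) //.
  - rewrite big_map; apply: eq_bigr => k _.
    by rewrite [a + k]addrC addrK.
  - by rewrite map_inj_uniq //; exact: addrI.
  - by move=> k kt; rewrite mu mem_cat kt orbT.
  - move=> k _ kt; rewrite c0 ?linear0 //; apply: contra kt => kt.
    by apply/mapP; exists (k - a); rewrite // addrC subrK.
have f0 : \sum_(k <- u) f k = 0.
  by rewrite big_split /= sumrN e1 e2 e subrr.
have fj : f j = 0.
  apply: (dsd_indep A uu _ f0) => [k|]; last by rewrite mu mem_cat sj.
  apply: (dsdB A); first by case: ifP => _; [have [] := hz k | exact: dsd0 A k].
  by have := diff_graded (hc (k - a)); rewrite /= addrC subrK.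
have [_ ->] := hz j; rewrite -(linear0 (hclass (diff D) (diff D))); apply/hclass_eq.
exists (c (j - a)); rewrite (linear0 (ker_val (diff D))) subr0.
by move/eqP: fj; rewrite /f sj subr_eq0 => /eqP.
Qed.

Lemma dh_scale n j (c : S) q : rgr n c -> dh_gr j q -> dh_gr (n%:Z + j) (c *: q).
Proof.
move=> hc [z hz ->]; exists (c *: z); last by rewrite linearZ.
exact: (gr_scale hc hz).
Qed.

(* H(D) = ker d / im d, graded so that d(-a) : D(-a) -> D has degree 0. *)
Definition dhomology : grModule S := GrModule dh_dec dh_scale.
End DiffHomology.

Record diffMorphism (S : gradedRing) (a : int) (D E : diffModule S a) := DiffMorphism {
  dfun :> {linear D -> E};
  dfun_graded : graded_map dfun;
  dfun_comm : forall x, dfun (diff D x) = diff E (dfun x) }.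

Section QuasiIsomorphism.
Variables (S : gradedRing) (a : int).
Implicit Types D E : diffModule S a.

Section InducedMap.
Variables (D E : diffModule S a) (f : diffMorphism D E).
Lemma dfun_ker (z : ker_type (diff D)) : diff E (f (ker_val _ z)) = 0.
Proof. by rewrite -dfun_comm ker_valP linear0. Qed.
Definition ker_map (z : ker_type (diff D)) : ker_type (diff E) :=
  ker_mk (dfun_ker z).

Lemma dhomology_rep (q : dhomology D) :
  exists z : ker_type (diff D), hclass (diff D) (diff D) z = q.
Proof. exact: hclass_surj. Qed.
(* The map H(D) -> H(E) sending the class of z to the class of f z, computed on
   a chosen representative; by [dhomology_mapE] the choice is irrelevant. *)
Definition dhomology_map (q : dhomology D) : dhomology E :=
  hclass (diff E) (diff E) (ker_map (projT1 (cid (dhomology_rep q)))).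
Lemma dhomology_mapE (z : ker_type (diff D)) :
  dhomology_map (hclass (diff D) (diff D) z) = hclass (diff E) (diff E) (ker_map z).
Proof.
rewrite /dhomology_map; case: cid => w /= /hclass_eq[u e].
by apply/hclass_eq; exists (f u); rewrite -dfun_comm -e /= linearB.
Qed.
End InducedMap.

Definition quasi_iso D E (f : diffMorphism D E) : Prop :=
  bijective (dhomology_map f).

(* D and E are connected by a zigzag of quasi-isomorphisms. *)
Definition quasi_isomorphic : diffModule S a -> diffModule S a -> Prop :=
  clos_refl_sym_trans _ (fun D E => exists f : diffMorphism D E, quasi_iso f).

Definition diff_isomorphic D E : Prop :=
  exists (f : diffMorphism D E) (g : diffMorphism E D), cancel f g /\ cancel g f.
End QuasiIsomorphism.

Section Fold.
Variables (S : gradedRing) (a : int) (C : grComplex S).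

(* The graded module \bigoplus_i C_i(ia). *)
Definition fold_mod : grModule S := gdsum (fun i => twist (C i) (a *+ i)).

Lemma fold_fun_finsupp (x : fold_mod) :
  exists n, forall i, (n <= i)%N -> bd C i (dsum_coord i.+1 x) = 0.
Proof.
have [n hn] := dsum_finsupp x; exists n => i ni.
by rewrite hn ?linear0 // (leq_trans ni).
Qed.
Definition fold_fun (x : fold_mod) : fold_mod := dsum_mk (fold_fun_finsupp x).
Lemma fold_fun_linear : linear fold_fun.
Proof. by move=> c x y; apply: dsumP => i; exact: (linearP (bd C i)). Qed.
HB.instance Definition _ :=
  GRing.isLinear.Build S fold_mod fold_mod *:%R fold_fun fold_fun_linear.

Lemma fold_graded : @graded_map S fold_mod (twist fold_mod a) fold_fun.
Proof.
move=> j x hx i /=; rewrite addrA -mulrSr; exact: (bd_graded (hx i.+1)).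
Qed.
Lemma fold_sq x : fold_fun (fold_fun x) = 0.
Proof. by apply: dsumP => i; exact: bd_sq. Qed.

Definition Fold : diffModule S a := @DiffModule S a fold_mod fold_fun fold_graded fold_sq.

(* Degree a free flags anchored on the complex C of free modules.  Elements of
   the i-th summand are the x with all other coordinates zero. *)
Record freeFlag := FreeFlag {
  flag_diff : {linear fold_mod -> fold_mod};
  flag_graded : @graded_map S fold_mod (twist fold_mod a) flag_diff;
  flag_sq : forall x, flag_diff (flag_diff x) = 0;
  flag_lower : forall i (x : fold_mod),
    (forall k, k <> i -> dsum_coord k x = 0) ->
    forall j, (i <= j)%N -> dsum_coord j (flag_diff x) = 0;
  flag_anchor : forall i (x : fold_mod),
    (forall k, k <> i.+1 -> dsum_coord k x = 0) ->
    dsum_coord i (flag_diff x) = bd C i (dsum_coord i.+1 x) }.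

Definition flag_module (D : freeFlag) : diffModule S a :=
  DiffModule (@flag_graded D) (@flag_sq D).

Definition rigid_complex : Prop :=
  (forall i, gr_free (C i)) /\
  forall D : freeFlag, diff_isomorphic (flag_module D) Fold.
End Fold.

Definition rigid_module (S : gradedRing) (a : int) (M : grModule S) : Prop :=
  exists2 F : grComplex S, free_resolution F M & rigid_complex a F.

(* Main.v *)
From HB Require Import structures.
Require Import Defs.
From mathcomp Require Import all_boot all_order all_algebra.
From mathcomp Require Import boolp.
From Stdlib Require Import Relation_Operators.
Import GRing.Theory.
Local Open Scope ring_scope.

Set Implicit Arguments.
Unset Strict Implicit.
Unset Printing Implicit Defensive.

(** Let [D] be a degree [a] differential module with homology [M]. A morphism
    from [Fold F] to [D] inducing the given isomorphism on homology is built one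
    [F_i] at a time: [f_(i+1)] must satisfy [d f_(i+1) = f_i bd]. The cycles
    [f_(i+1) bd x], for [x] in [F_(i+2)], define a cocycle [F_(i+2) -> M] of
    degree [a - a (i+2)]; by the vanishing of Ext (automatic above the projective
    dimension) it bounds a map [F_(i+1) -> M], and subtracting a lift of that map
    to the cycles of [D] from [f_(i+1)] turns the cycles [f_(i+1) bd x] into
    boundaries, so that [f_(i+2)] exists. For a free flag the homology is [M] as well, and the same
    construction can be carried out keeping [f_i] equal to the inclusion of [F_i]
    modulo lower summands; the resulting morphism is then unipotent, hence an
    isomorphism. *)

(** * Homogeneous components with respect to a direct sum decomposition *)

Section Components.
Variables (I : choiceType) (V : zmodType) (A : I -> V -> Prop).
Hypothesis decA : direct_sum_decomp A.

Lemma comp_exists (x : V) : exists c : I -> V,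
  (forall i, A i (c i)) /\
  exists2 s : seq I, uniq s &
    (forall i, i \notin s -> c i = 0) /\ x = \sum_(i <- s) c i.
Proof. by have [s [c [us cA c0 ->]]] := dsd_comp decA x; exists c; split=> //; exists s. Qed.

(** The decomposition is obtained by choice; [comp_unique] shows that the result does not depend on
    it. *)
Definition comp (i : I) (x : V) : V := projT1 (cid (comp_exists x)) i.

Lemma comp_homo i x : A i (comp i x).
Proof. by rewrite /comp; case: cid => c []. Qed.

Lemma comp_sum x : exists2 s : seq I, uniq s &
  (forall i, i \notin s -> comp i x = 0) /\ x = \sum_(i <- s) comp i x.
Proof. by rewrite /comp; case: cid => c []. Qed.

(** Both families are extended by zero to the union of their supports; their difference sums to
    zero, so independence of the summands applies. *)
Lemma comp_unique (s : seq I) (c : I -> V) x : uniq s -> (forall i, A i (c i)) ->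
  (forall i, i \notin s -> c i = 0) -> x = \sum_(i <- s) c i ->
  forall i, comp i x = c i.
Proof.
move=> us cA c0 ex i; have [t ut [ct0 et]] := comp_sum x.
have [u uu mu] : exists2 u, uniq u & u =i s ++ t.
  by exists (undup (s ++ t)); [exact: undup_uniq|exact: mem_undup].
have su j : j \in s -> j \in u by rewrite mu mem_cat => ->.
have tu j : j \in t -> j \in u by rewrite mu mem_cat orbC => ->.
have [iu|] := boolP (i \in u); last first.
  by rewrite mu mem_cat negb_or => /andP[/c0 -> /ct0 ->].
apply/eqP; rewrite -subr_eq0; apply/eqP.
apply: (dsd_indep decA (c := fun j => comp j x - c j) uu) => //.
  by move=> j; apply: dsdB => //; exact: comp_homo.
rewrite sumrB (big_uniq_sub ut uu tu (F := comp^~ x)); last by move=> j _ /ct0.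
by rewrite (big_uniq_sub us uu su (F := c)) -?ex -?et ?subrr // => j _ /c0.
Qed.

Lemma comp_id i x : A i x -> comp i x = x.
Proof.
move=> xA; rewrite (@comp_unique [:: i] (fun j => if j == i then x else 0)) ?eqxx //.
- by move=> j; case: eqP => [->|_] //; exact: dsd0.
- by move=> j; rewrite inE => /negbTE ->.
- by rewrite big_seq1 eqxx.
Qed.

Lemma comp_neq i j x : A i x -> j != i -> comp j x = 0.
Proof.
move=> xA ji.
rewrite (@comp_unique [:: i] (fun j => if j == i then x else 0)) ?(negbTE ji) //.
- by move=> k; case: eqP => [->|_] //; exact: dsd0.
- by move=> k; rewrite inE => /negbTE ->.
- by rewrite big_seq1 eqxx.
Qed.

Lemma compB i : zmod_morphism (comp i).
Proof.
move=> x y; have [s us [xs0 xs]] := comp_sum x; have [t ut [yt0 yt]] := comp_sum y.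
have [u uu mu] : exists2 u, uniq u & u =i s ++ t.
  by exists (undup (s ++ t)); [exact: undup_uniq|exact: mem_undup].
have su j : j \in s -> j \in u by rewrite mu mem_cat => ->.
have tu j : j \in t -> j \in u by rewrite mu mem_cat orbC => ->.
apply: (@comp_unique u (fun i => comp i x - comp i y)) => //.
- by move=> j; apply: dsdB => //; exact: comp_homo.
- by move=> j; rewrite mu mem_cat negb_or => /andP[/xs0 -> /yt0 ->]; rewrite subrr.
rewrite sumrB (big_uniq_sub us uu su (F := comp^~ x)); last by move=> j _ /xs0.
by rewrite (big_uniq_sub ut uu tu (F := comp^~ y)) -?xs -?yt // => j _ /yt0.
Qed.

HB.instance Definition _ i := GRing.isZmodMorphism.Build V V (comp i) (compB i).

End Components.

(** Applying [f] to the components of [x] decomposes [f x]; injectivity of [h] prevents two of the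
    pieces from landing in the same degree. *)
Lemma comp_map (I J : choiceType) (V W : zmodType) (A : I -> V -> Prop)
    (B : J -> W -> Prop) (decA : direct_sum_decomp A) (decB : direct_sum_decomp B)
    (h : I -> J) (f : {additive V -> W}) :
  injective h -> (forall i x, A i x -> B (h i) (f x)) ->
  forall i x, comp decB (h i) (f x) = f (comp decA i x).
Proof.
move=> h_inj fAB i x; have [s us [c0 ex]] := comp_sum decA x.
have [si|si] := boolP (i \in s); last first.
  rewrite c0 // raddf0 {1}ex raddf_sum raddf_sum big1_seq // => j /andP[_ sj].
  apply: comp_neq (fAB _ _ (comp_homo decA j x)) _.
  by apply: contra si => /eqP/h_inj ->.
rewrite {1}ex raddf_sum raddf_sum (bigD1_seq i) //= big1 ?addr0.
  by apply: comp_id; apply: fAB; exact: comp_homo.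
move=> j ji; apply: comp_neq (fAB _ _ (comp_homo decA j x)) _.
by rewrite (inj_eq h_inj) eq_sym.
Qed.

Lemma linear_exists (R : comNzRingType) (U V : lmodType R) (f : U -> V) :
  linear f -> exists g : {linear U -> V}, g =1 f.
Proof.
move=> hf.
pose fM := GRing.isLinear.Build R U V *:%R f hf.
pose g : {linear U -> V} := HB.pack f fM.
by exists g.
Qed.

(** * Homogeneous maps and graded free modules *)

Section GradedModuleTheory.
Variable S : gradedRing.
Implicit Types M N V : grModule S.

Definition gcomp M k (x : M) : M := comp (gr_dec M) k x.

Definition homogeneous_map M N (e : int) (f : M -> N) : Prop :=
  forall k x, gr M k x -> gr N (k + e) (f x).

Lemma gcomp_map M N e (f : {linear M -> N}) k x :
  homogeneous_map e f -> gcomp (k + e) (f x) = f (gcomp k x).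
Proof.
move=> fe.
exact: (@comp_map _ _ _ _ _ _ (gr_dec M) (gr_dec N) (fun k => k + e) f (addIr e) fe).
Qed.

(** Used to replace an arbitrary preimage of a homogeneous element by a homogeneous one. *)
Lemma homogeneous_preimage M N e (f : {linear M -> N}) k x y :
  homogeneous_map e f -> gr N (k + e) y -> f x = y -> f (gcomp k x) = y.
Proof. by move=> fe yk fx; rewrite -(gcomp_map k x fe) fx; exact: comp_id. Qed.

Lemma gcomp_gr M k (x : M) : gr M k (gcomp k x).
Proof. exact: comp_homo. Qed.

(* In degrees below j the component vanishes because S has no negative degrees. *)
Lemma gcompZ M (c : S) j (y : M) k : gr M j y ->
  exists c' : S, (c' = 0 \/ exists2 m : nat, rgr m c' & m%:Z + j = k) /\
    gcomp k (c *: y) = c' *: y.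
Proof.
move=> yj; have [s us [c0 ->]] := comp_sum (rgr_dec S) c.
have e1 m : gcomp k (comp (rgr_dec S) m c *: y) =
    if m%:Z + j == k then comp (rgr_dec S) m c *: y else 0.
  have h := gr_scale (comp_homo (rgr_dec S) m c) yj.
  case: eqP => [<-|/eqP mk]; first exact: comp_id.
  by apply: (comp_neq (gr_dec M) h); rewrite eq_sym.
rewrite scaler_suml /gcomp raddf_sum.
rewrite (eq_bigr _ (fun m _ => e1 m)).
have [[m mk]|nk] := pselect (exists m : nat, m%:Z + j = k); last first.
  exists 0; split; first by left.
  rewrite scale0r big1 // => m _; case: eqP => // mk; case: nk; by exists m.
exists (comp (rgr_dec S) m c); split.
  by right; exists m => //; exact: comp_homo.
have em i : (i%:Z + j == k) = (i == m) by rewrite -mk (inj_eq (addIr j)).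
rewrite (eq_bigr _ (fun i _ => congr1 (fun b : bool => if b then _ else _) (em i))).
have [ms|ms] := boolP (m \in s).
  rewrite (bigD1_seq m) //= eqxx big1 ?addr0 // => i /negbTE -> //.
rewrite (c0 m) // scale0r big1_seq // => i /andP[_ si].
by case: eqP => // im; rewrite -im si in ms.
Qed.

(** Uniqueness of coordinates gives their linearity. It also makes the coordinates of a homogeneous
    element homogeneous: taking components in an expansion yields a second expansion of the same
    element. *)
Lemma gr_free_coord V : gr_free V ->
  exists n (b : 'I_n -> int) (e : 'I_n -> V) (co : 'I_n -> V -> S),
  [/\ forall i, gr V (b i) (e i),
      forall x, x = \sum_(i < n) co i x *: e i,
      forall i (c : S) x y, co i (c *: x + y) = c * co i x + co i y
    & forall i k x, gr V k x ->
        co i x = 0 \/ exists2 m : nat, rgr m (co i x) & m%:Z + b i = k].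
Proof.
move=> [n [b [e [be ee]]]].
have /choice[co hco] x : exists c : {ffun 'I_n -> S}, x = \sum_(i < n) c i *: e i.
  by have [c []] := ee x; exists c.
have co_uniq x (c : 'I_n -> S) : x = \sum_(i < n) c i *: e i -> co x =1 c.
  move=> xc; have [c0 [_ h]] := ee x.
  have -> : co x = finfun c; last by move=> i; rewrite ffunE.
  rewrite -(h (co x) (hco x)) -(h (finfun c)) // {1}xc.
  by apply: eq_bigr => i _; rewrite ffunE.
exists n, b, e, (fun i x => co x i); split=> //.
  move=> i c x y; rewrite (co_uniq _ (fun i => c * co x i + co y i)) //.
  under eq_bigr => j _ do rewrite scalerDl -scalerA.
  by rewrite big_split -scaler_sumr -!hco.
move=> i k x xk.
have /choice[c' hc'] j := gcompZ (co x j) k (be j).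
rewrite (co_uniq x c'); first by have [] := hc' i.
rewrite -{1}(comp_id (gr_dec V) xk) {1}(hco x) raddf_sum.
by apply: eq_bigr => j _; have [] := hc' j.
Qed.

(** Homogeneous values are chosen on a basis and extended linearly. A linear relation [T] in place
    of a surjection lets several conditions on the lift be imposed at once. *)
Lemma gr_free_lift V N (e : int) (T : V -> N -> Prop) : gr_free V ->
  (forall (c : S) x y x' y', T x y -> T x' y' -> T (c *: x + x') (c *: y + y')) ->
  (forall k x, gr V k x -> exists2 y, gr N (k + e) y & T x y) ->
  exists2 g : {linear V -> N}, homogeneous_map e g & forall x, T x (g x).
Proof.
move=> /gr_free_coord[n [b [v [co [bv xv colin cogr]]]]] Tlin Tex.
(* Any related pair minus itself. *)
have T0 : T 0 0.
  have [y _ Ty] := Tex 0 0 (dsd0 (gr_dec V) 0).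
  by have := Tlin (-1) _ _ _ _ Ty Ty; rewrite !scaleN1r !addNr.
have /choice[y hy] i : exists y, gr N (b i + e) y /\ T (v i) y.
  by have [y] := Tex _ _ (bv i); exists y.
have [|g gE] := @linear_exists _ V N (fun x => \sum_(i < n) co i x *: y i).
  move=> c x x'; rewrite scaler_sumr -big_split; apply: eq_bigr => i _.
  by rewrite colin scalerDl scalerA.
exists g => [k x xk|x]; rewrite gE.
  apply: (big_ind (gr N (k + e))) => [|u w|i _].
  - exact: dsd0 (gr_dec N) _.
  - exact: dsdD (gr_dec N) _ _ _.
  have [->|[m hm <-]] := cogr i k x xk; first by rewrite scale0r; exact: dsd0 (gr_dec N) _.
  by rewrite -addrA; apply: gr_scale => //; have [] := hy i.
rewrite {1}(xv x); apply: (big_rec2 T) => // i u w _ Tuw.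
by apply: Tlin => //; have [] := hy i.
Qed.

(** The degree [e] part of [u], defined on a homogeneous basis. It serves to make a bounding cochain
    homogeneous. *)
Lemma homogeneous_part V N (e : int) (u : {linear V -> N}) : gr_free V ->
  exists2 u' : {linear V -> N}, homogeneous_map e u' &
    forall k x, gr V k x -> u' x = gcomp (k + e) (u x).
Proof.
move=> /gr_free_coord[n [b [v [co [bv xv colin cogr]]]]].
have [|g gE] := @linear_exists _ V N
    (fun x => \sum_(i < n) co i x *: gcomp (b i + e) (u (v i))).
  move=> c x x'; rewrite scaler_sumr -big_split; apply: eq_bigr => i _.
  by rewrite colin scalerDl scalerA.
have gu k x : gr V k x -> g x = gcomp (k + e) (u x).
  move=> xk; rewrite gE {2}(xv x) linear_sum /gcomp raddf_sum.
  apply: eq_bigr => i _; rewrite linearZ /=.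
  have [->|[m hm <-]] := cogr i k x xk; first by rewrite !scale0r raddf0.
  have hN : injective (fun j : int => m%:Z + j) by exact: addrI.
  rewrite -addrA.
  pose f : {additive N -> N} := *:%R (co i x).
  rewrite (@comp_map _ _ _ _ _ _ (gr_dec N) (gr_dec N) _ f hN) //.
  by move=> j y; exact: gr_scale.
by exists g => // k x xk; rewrite (gu k) //; exact: gcomp_gr.
Qed.

Lemma linear_homogeneous_ext V N (f g : {linear V -> N}) :
  (forall k x, gr V k x -> f x = g x) -> f =1 g.
Proof.
move=> fg x; have [s _ [_ ->]] := comp_sum (gr_dec V) x.
by rewrite !linear_sum; apply: eq_bigr => k _; apply: (fg k); exact: comp_homo.
Qed.

Lemma gr_free_projective V : gr_free V -> projective V.
Proof.
move=> /gr_free_coord[n [b [v [co [_ xv colin _]]]]] U W g f g_surj.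
have /choice[y hy] i := g_surj (f (v i)).
have [|h hE] := @linear_exists _ V U (fun x => \sum_(i < n) co i x *: y i).
  move=> c x x'; rewrite scaler_sumr -big_split; apply: eq_bigr => i _.
  by rewrite colin scalerDl scalerA.
exists h => x; rewrite hE linear_sum [in RHS](xv x) linear_sum.
by apply: eq_bigr => i _; rewrite !linearZ /= hy.
Qed.

End GradedModuleTheory.

(** Dependent choice with types varying with [n], as for maps out of the terms of a complex; [G] is
    the invariant that allows the next step. *)
Lemma dependent_sequence (A : nat -> Type) (G : forall n, A n -> Prop)
    (R : forall n, A n -> A n.+1 -> Prop) (a0 : A 0%N) :
  G 0%N a0 -> (forall n a, G n a -> exists a', G n.+1 a' /\ R n a a') ->
  exists s : forall n, A n, s 0%N = a0 /\ forall n, G n (s n) /\ R n (s n) (s n.+1).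
Proof.
move=> Ga0 step.
have next n (a : {a | G n a}) : {a' : {a | G n.+1 a} | R n (projT1 a) (projT1 a')}.
  have [a' [Ga' Ra]] := cid (step n (projT1 a) (projT2 a)).
  by exists (exist _ a' Ga').
pose s := fix s n : {a | G n a} :=
  if n is m.+1 then projT1 (next m (s m)) else exist _ a0 Ga0.
exists (fun n => projT1 (s n)); split=> // n; split; first exact: projT2 (s n).
exact: projT2 (next n (s n)).
Qed.

(** * Lifting from projective modules and comparison of resolutions *)

Section ProjectiveLift.
Variables (R : comNzRingType) (P V : lmodType R) (T : P -> V -> Prop).
Hypothesis T_linear : forall (c : R) x y x' y',
  T x y -> T x' y' -> T (c *: x + x') (c *: y + y').
Hypothesis T_total : forall x, exists y, T x y.

Definition graph_pred : {pred (P * V)%type} := fun z => `[< T z.1 z.2 >].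

Lemma graph_pred_closed : subsemimod_closed graph_pred.
Proof.
apply: GRing.submod_closed_semi; split=> [|c [x y] [x' y'] /asboolP h /asboolP h'].
  apply/asboolP; have [y Ty] := T_total 0.
  by have := T_linear (-1) Ty Ty; rewrite !scaleN1r !addNr.
by apply/asboolP; exact: T_linear.
Qed.
HB.instance Definition _ :=
  GRing.isSubmodClosed.Build R (P * V)%type graph_pred graph_pred_closed.

(** The graph of [T] is a submodule of [P * V] projecting onto [P]. Projectivity splits this
    projection, and the second coordinate of the splitting is the required map. *)
Lemma projective_lift : projective P ->
  exists g : {linear P -> V}, forall x, T x (g x).
Proof.
move=> projP; pose U : lmodType R := submod_type graph_pred.
have [//|p1 p1E] := @linear_exists _ U P (fun u => (submod_val u).1).
have [//|p2 p2E] := @linear_exists _ U V (fun u => (submod_val u).2).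
have [|h hE] := projP _ _ p1 idfun.
  move=> x; have [y Txy] := T_total x.
  have Txy' : (x, y) \in graph_pred by exact/asboolP.
  by exists (SubMod Txy'); rewrite p1E.
exists (p2 \o h) => x; have /asboolP := submod_valP (h x).
by rewrite -[(submod_val _).1]p1E -[(submod_val _).2]p2E hE.
Qed.
End ProjectiveLift.

Section Comparison.
Variables (R : comNzRingType) (M : lmodType R).
Variables (X : nat -> lmodType R) (dX : forall i, {linear X i.+1 -> X i}).
Variable epsX : {linear X 0%N -> M}.
Hypothesis X_projective : forall i, projective (X i).
Hypothesis epsX_d : forall x, epsX (dX 0%N x) = 0.
Hypothesis dX_sq : forall i x, dX i (dX i.+1 x) = 0.

Lemma comparison_map (Y : nat -> lmodType R) (dY : forall i, {linear Y i.+1 -> Y i})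
    (epsY : {linear Y 0%N -> M}) :
  (forall m, exists y, epsY y = m) ->
  (forall y, epsY y = 0 -> exists y', y = dY 0%N y') ->
  (forall i y, dY i y = 0 -> exists y', y = dY i.+1 y') ->
  exists phi : forall i, {linear X i -> Y i},
    (forall x, epsY (phi 0%N x) = epsX x) /\
    forall i x, dY i (phi i.+1 x) = phi i (dX i x).
Proof.
move=> epsY_surj exY0 exY.
have [|x|phi0 phi0E] := @projective_lift _ _ _ (fun x y => epsY y = epsX x) _ _ (@X_projective 0%N).
- by move=> c x y x' y' h h'; rewrite !linearP /= h h'.
- exact: epsY_surj.
(* The invariant says that the next lift exists pointwise; exactness of [Y] restores it after each
   step. *)
pose G i (phi : {linear X i -> Y i}) := forall x, exists y, dY i y = phi (dX i x).
pose Q i (phi : {linear X i -> Y i}) (psi : {linear X i.+1 -> Y i.+1}) :=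
  forall x, dY i (psi x) = phi (dX i x).
have [|i phi Gphi|phi [phi0' phiE]] := @dependent_sequence _ G Q phi0.
- move=> x; have [|y ->] := exY0 (phi0 (dX 0%N x)); last by exists y.
  by rewrite phi0E epsX_d.
- have [|psi psiE] := projective_lift _ Gphi (@X_projective i.+1).
    by move=> c x y x' y' h h'; rewrite !linearP /= h h'.
  exists psi; split=> // x; have [|y ->] := exY i (psi (dX i.+1 x)); last by exists y.
  by rewrite psiE dX_sq linear0.
exists phi; split=> [x|i x]; first by rewrite phi0'.
by have [_] := phiE i; exact.
Qed.

(** The usual homotopy between a lift [theta] of the identity and the identity itself: each
    right-hand side is a cycle, hence a boundary by exactness. *)
Lemma comparison_homotopy (theta : forall i, {linear X i -> X i}) :
  (forall x, epsX x = 0 -> exists y, x = dX 0%N y) ->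
  (forall i x, dX i x = 0 -> exists y, x = dX i.+1 y) ->
  (forall x, epsX (theta 0%N x) = epsX x) ->
  (forall i x, dX i (theta i.+1 x) = theta i (dX i x)) ->
  exists h : forall i, {linear X i -> X i.+1},
    forall i x, dX i.+1 (h i.+1 x) = x - theta i.+1 x - h i (dX i x).
Proof.
move=> exX0 exX eps_theta d_theta.
have [| |h0 h0E] := @projective_lift _ _ _
    (fun x y => dX 0%N y = x - theta 0%N x) _ _ (@X_projective 0%N).
- move=> c x y x' y' h h'; rewrite linearP h h' linearP /= scalerBr.
  by rewrite addrACA -opprD.
- move=> x; have [|y ->] := exX0 (x - theta 0%N x); last by exists y.
  by rewrite linearB /= eps_theta subrr.
pose G i (h : {linear X i -> X i.+1}) :=
  forall x, exists y, dX i.+1 y = x - theta i.+1 x - h (dX i x).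
pose Q i (h : {linear X i -> X i.+1}) (h' : {linear X i.+1 -> X i.+2}) :=
  forall x, dX i.+1 (h' x) = x - theta i.+1 x - h (dX i x).
have [|i h Gh|h [_ hE]] := @dependent_sequence _ G Q h0.
- move=> x; have [|y ->] := exX 0%N (x - theta 1%N x - h0 (dX 0%N x)); last by exists y.
  by rewrite !linearB /= h0E d_theta subrr.
- have [|h' h'E] := projective_lift _ Gh (@X_projective i.+1).
    move=> c x y x' y' e e'; rewrite linearP e e' !linearP /= !scalerBr.
    by rewrite addrACA (addrACA (c *: x)) !scalerN -!opprD.
  exists h'; split=> // x.
  have [|y ->] := exX i.+1 (x - theta i.+2 x - h' (dX i.+1 x)); last by exists y.
  by rewrite !linearB /= h'E d_theta dX_sq linear0 subr0 subrr.
by exists h => i x; have [_] := hE i; exact.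
Qed.
End Comparison.

(** * From vanishing of Ext to bounded cocycles *)

Section ExtVanishing.
Variables (S : gradedRing) (M : grModule S) (F : grComplex S).
Hypothesis F_resolution : free_resolution F M.

(** Some projective resolution [P] of [M] vanishes in degree i+1. The identity of [F] is homotopic
    to a map through [P], so in degree i+1 the element [x - h i (bd F i x)] is a boundary. As [z]
    kills boundaries, it equals [z \o h i \o bd F i]. *)
Lemma Ext_above_pdim i (N : grModule S) (z : {linear F i.+1 -> N}) :
  ~ le_pdim i.+1 M -> (forall x, z (bd F i.+1 x) = 0) ->
  exists u : {linear F i -> N}, forall x, z x = u (bd F i x).
Proof.
move=> npd zbd.
have [n [P [d [epsP [projP P0 epsP_surj exP0 exP]]]] ni] :
    exists2 n, proj_resolution_of_length M n & (n < i.+1)%N.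
  apply: contra_notP npd => h n resn; rewrite leqNgt; apply/negP => ni.
  by apply: h; exists n.
have [Ffree [eps [eps_gr eps_surj exF0 exF]]] := F_resolution.
have Fproj j : projective (F j) by exact: gr_free_projective.
have epsbd x : eps (bd F 0 x) = 0 by apply/exF0; exists x.
have epsd x : epsP (d 0%N x) = 0 by apply/exP0; exists x.
have [|||phi [phi0 phid]] := @comparison_map _ M (fun j => F j) (bd F) eps Fproj epsbd (@bd_sq S F) P d epsP.
- exact: epsP_surj.
- by move=> y /exP0.
- by move=> j y /exP.
have d_sq j x : d j (d j.+1 x) = 0 by apply/exP; exists x.
have [|||psi [psi0 psid]] := @comparison_map _ M P d epsP projP epsd d_sq (fun j => F j) (bd F) eps.
- exact: eps_surj.
- by move=> y /exF0.
- by move=> j y /exF.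
have [|||||h hE] := @comparison_homotopy _ M (fun j => F j) (bd F) eps Fproj _ (fun j => psi j \o phi j).
- exact: (@bd_sq S F).
- by move=> x /exF0.
- by move=> j x /exF.
- by move=> x /=; rewrite psi0 phi0.
- by move=> j x /=; rewrite psid phid.
exists (z \o h i) => x /=; apply/eqP; rewrite -subr_eq0 -linearB.
suff -> : x - h i (bd F i x) = bd F i.+1 (h i.+1 x) by rewrite zbd.
by rewrite hE /= (P0 _ ni (phi i.+1 x)) linear0 subr0.
Qed.

(** Up to the projective dimension this is the Ext hypothesis in degree i+2, and beyond it
    [Ext_above_pdim]. The bounding map found may be inhomogeneous; since [z] and [bd] are
    homogeneous, its part of the right degree still bounds [z]. *)
Lemma cocycle_is_coboundary (a : int) i (z : {linear F i.+2 -> M}) :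
  (forall i : nat, (2 <= i)%N -> le_pdim i M ->
     forall q : Ext F M i, Ext_gr (a - a *+ i) q -> q = 0) ->
  homogeneous_map (a - a *+ i.+2) z -> (forall x, z (bd F i.+2 x) = 0) ->
  exists2 u : {linear F i.+1 -> M}, homogeneous_map (a - a *+ i.+2) u &
    forall x, z x = u (bd F i.+1 x).
Proof.
move=> Ext0 z_gr zbd.
have [u uE] : exists u : {linear F i.+1 -> M}, forall x, z x = u (bd F i.+1 x).
  have [pd|npd] := pselect (le_pdim i.+2 M); last exact: Ext_above_pdim.
  have cz : cobd F M i.+2 (hom_mk z) = 0 by apply: homP => x; exact: zbd.
  have := Ext0 i.+2 isT pd (hclass (cobd_in F M i.+2) (cobd F M i.+2) (ker_mk cz)).
  rewrite -[RHS](linear0 (hclass (cobd_in F M i.+2) (cobd F M i.+2))) => h.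
  have /hclass_eq[u] : hclass (cobd_in F M i.+2) (cobd F M i.+2) (ker_mk cz) =
      hclass (cobd_in F M i.+2) (cobd F M i.+2) 0.
    by apply: h; exists (ker_mk cz).
  rewrite (linear0 (ker_val (cobd F M i.+2))) subr0 => /(congr1 (fun f => hom_fun f)) e.
  exists (hom_fun u) => x; exact: (congr1 (fun f => f x) e).
have [Ffree _] := F_resolution.
have [u' u'_gr u'E] := homogeneous_part (a - a *+ i.+2) u (Ffree i.+1).
exists u' => //; apply: (@linear_homogeneous_ext _ _ _ z (u' \o bd F i.+1)) => k x xk /=.
rewrite (u'E k) -?uE; last exact: bd_graded.
by rewrite /gcomp comp_id //; exact: z_gr.
Qed.
End ExtVanishing.

(** * Stepwise lifting of a free complex to a differential module *)

Section Obstruction.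
Variables (S : gradedRing) (a : int) (M : grModule S) (F : grComplex S).
Hypothesis F_free : forall i, gr_free (F i).
Hypothesis cocycles_bound : forall i (z : {linear F i.+2 -> M}),
  homogeneous_map (a - a *+ i.+2) z -> (forall x, z (bd F i.+2 x) = 0) ->
  exists2 u : {linear F i.+1 -> M}, homogeneous_map (a - a *+ i.+2) u &
    forall x, z x = u (bd F i.+1 x).

(** [K z m] stands for a cycle [z] with class [m] in [M]. It is kept abstract to serve twice: for a
    given isomorphism from homology to [M], and for an explicit normal form of the cycles of a
    flag. *)
Variables (D : diffModule S a) (K : D -> M -> Prop).
Hypothesis K_linear : forall (c : S) z m z' m',
  K z m -> K z' m' -> K (c *: z + z') (c *: m + m').
Hypothesis K_cycle : forall z m, K z m -> diff D z = 0.
Hypothesis K_total : forall z, diff D z = 0 -> exists m, K z m.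
Hypothesis K_unique : forall z m m', K z m -> K z m' -> m = m'.
Hypothesis K_boundary : forall y, K (diff D y) 0.
Hypothesis K_comp : forall k z m, K z m -> K (gcomp k z) (gcomp k m).

(** [P i] limits how far the map on [F i] may deviate from a first guess [s i]: no limit for a
    general differential module, support in lower summands for a flag. *)
Variable P : nat -> D -> Prop.
Hypothesis P_linear : forall i (c : S) x y, P i x -> P i y -> P i (c *: x + y).
Hypothesis P_comp : forall i k x, P i x -> P i (gcomp k x).
Hypothesis P_bounding : forall i z, P i z -> K z 0 ->
  exists2 y, P i.+1 y & diff D y = z.
Hypothesis P_class : forall i m, exists2 z, P i.+1 z & K z m.

Variable s : forall i, {linear F i -> D}.
Hypothesis s_homogeneous : forall i, homogeneous_map (- (a *+ i)) (s i).
Hypothesis s_anchor : forall i x, P i (s i (bd F i x) - diff D (s i.+1 x)).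
Hypothesis s_class : forall x, K (s 0%N (bd F 0 x)) 0.

Lemma diff_homogeneous : homogeneous_map a (diff D).
Proof. by move=> k x xk; rewrite addrC; exact: (diff_graded xk). Qed.

Lemma class_homogeneous k z m : gr D k z -> K z m -> gr M k m.
Proof.
move=> zk Kzm; have := K_comp k Kzm; rewrite {1}/gcomp comp_id // => Kzm'.
by rewrite (K_unique Kzm Kzm'); exact: gcomp_gr.
Qed.

Lemma P_add i x y : P i x -> P i y -> P i (x + y).
Proof. by move=> Px Py; rewrite -[x]scale1r; exact: P_linear. Qed.

Lemma P_zero i x : P i x -> P i 0.
Proof. by move=> Px; have := P_linear (-1) Px Px; rewrite scaleN1r addNr. Qed.

Lemma P_opp i x : P i x -> P i (- x).
Proof.
by move=> Px; have := P_linear (-1) Px (P_zero Px); rewrite scaleN1r addr0.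
Qed.

(** The last condition makes the cycles [f (bd F i x)] boundaries, which is what the existence of
    the next map requires. *)
Definition partial_lift i (f : {linear F i -> D}) : Prop :=
  [/\ homogeneous_map (- (a *+ i)) f, forall x, P i (f x - s i x)
    & forall x, K (f (bd F i x)) 0].

(** The unknown is the deviation from [s i.+1]: its differential must be [w], a cycle of class 0 in
    [P i], so [P_bounding] applies. The last condition of [partial_lift] may still fail for the
    resulting map. *)
Lemma partial_lift_uncorrected i (f : {linear F i -> D}) : partial_lift f ->
  exists2 g : {linear F i.+1 -> D}, homogeneous_map (- (a *+ i.+1)) g &
    forall x, P i.+1 (g x - s i.+1 x) /\ diff D (g x) = f (bd F i x).
Proof.
move=> [f_gr fs Kf].
pose T x y := P i.+1 y /\ diff D y = f (bd F i x) - diff D (s i.+1 x).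
have [| |g g_gr gT] := @gr_free_lift _ _ D (- (a *+ i.+1)) T (F_free i.+1).
- move=> c x y x' y' [Py ey] [Py' ey']; split; first exact: P_linear.
  rewrite linearP ey ey' !(linearP (bd F i), linearP f, linearP (s i.+1)).
  by rewrite (linearP (diff D)) scalerBr addrACA -opprD.
- move=> k x xk.
  pose w := f (bd F i x) - diff D (s i.+1 x).
  have degs : k - a *+ i = k - a *+ i.+1 + a.
    by rewrite mulrS opprD -!addrA [- (a *+ i) + a]addrC addKr.
  have wk : gr D (k - a *+ i) w.
    apply: (dsdB (gr_dec D)); first exact/f_gr/bd_graded.
    by rewrite degs; exact/diff_homogeneous/s_homogeneous.
  (* Here [w] is the deviation of [f] from [s i] at [bd F i x], plus the failure of [s] to commute
     with the differentials. *)
  have Pw : P i w.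
    rewrite /w -[f _](subrK (s i (bd F i x))) -addrA.
    by apply: P_add; [exact: fs | exact: s_anchor].
  have Kw : K w 0.
    have := K_linear (-1) (K_boundary (s i.+1 x)) (Kf x).
    by rewrite scaler0 addr0 scaleN1r addrC.
  have [y Py dy] := P_bounding Pw Kw.
  exists (gcomp (k - a *+ i.+1) y); first exact: gcomp_gr.
  split; first exact: P_comp.
  by apply: (homogeneous_preimage diff_homogeneous _ dy); rewrite -degs.
have [c x y|h hE] := @linear_exists _ _ _ (fun x => s i.+1 x + g x).
  by rewrite !linearP scalerDr addrACA.
exists h => [k x xk|x]; rewrite hE.
  by apply: (dsdD (gr_dec D)); [exact: s_homogeneous | exact: g_gr].
have [Pg dg] := gT x; split; first by rewrite addrC addKr.
by rewrite linearD dg addrC subrK.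
Qed.

Lemma partial_lift_step i (f : {linear F i -> D}) : partial_lift f ->
  exists f' : {linear F i.+1 -> D}, partial_lift f' /\
    forall x, diff D (f' x) = f (bd F i x).
Proof.
move=> /partial_lift_uncorrected[g g_gr gP].
(* The map [o] is the obstruction: the class of the cycle [g (bd F i.+1 x)]. Uniqueness of classes
   makes it linear. *)
have /choice[o oE] x : exists m, K (g (bd F i.+1 x)) m.
  by apply: K_total; have [_ ->] := gP (bd F i.+1 x); rewrite bd_sq linear0.
have [c x y|z zE] := @linear_exists _ _ _ o.
  by apply: K_unique (oE _) _; rewrite !linearP; apply: K_linear.
have [k x xk|x|u u_gr uE] := @cocycles_bound i z.
- rewrite zE; apply: class_homogeneous (oE x).
  have -> : k + (a - a *+ i.+2) = k - a *+ i.+1.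
    by rewrite mulrS opprD [a + _]addrA subrr add0r.
  exact/g_gr/bd_graded.
- rewrite zE; apply: K_unique (oE _) _; rewrite bd_sq linear0.
  by have := K_boundary 0; rewrite linear0.
have [c x y x' y' [Py Ky] [Py' Ky']|k x xk|v v_gr vP] :=
    @gr_free_lift _ _ D (- (a *+ i.+1)) (fun x y => P i.+1 y /\ K y (u x)) (F_free i.+1).
- by split; [exact: P_linear | rewrite linearP; exact: K_linear].
- have [y Py Ky] := P_class i (u x).
  exists (gcomp (k - a *+ i.+1) y); first exact: gcomp_gr.
  split; first exact: P_comp.
  suff <- : gcomp (k - a *+ i.+1) (u x) = u x by exact: K_comp.
  apply: comp_id; have := u_gr k x xk.
  by rewrite mulrS opprD [a + _]addrA subrr add0r.
(* Subtracting the cycle-valued [v] leaves the differential of [g] unchanged, and removes the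
   obstruction because [v] has class [u] and [u] bounds [z]. *)
have [c x y|f' f'E] := @linear_exists _ _ _ (fun x => - v x + g x).
  by rewrite (linearP v) (linearP g) opprD scalerDr scalerN addrACA.
exists f'; split=> [|x]; last first.
  have [_ Kv] := vP x; have [_ <-] := gP x.
  by rewrite f'E linearD linearN /= (K_cycle Kv) oppr0 add0r.
split=> [k x xk|x|x]; rewrite f'E.
- by apply: (dsdD (gr_dec D)); [exact: dsdN (gr_dec D) _ _ (v_gr _ _ xk) | exact: g_gr].
- have [Pv _] := vP x; have [Pg _] := gP x.
  by rewrite -addrA; apply: P_add => //; exact: P_opp.
have [_ Kv] := vP (bd F i.+1 x); have := K_linear (-1) Kv (oE x).
by rewrite -zE uE scaleN1r scaleN1r addNr.
Qed.

(** Dependent choice along [partial_lift_step], starting at [s 0], where [s_class] supplies the last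
    condition of [partial_lift]. *)
Lemma lift_exists : (forall i, P i 0) ->
  exists f : forall i, {linear F i -> D},
  [/\ f 0%N = s 0%N, forall i, homogeneous_map (- (a *+ i)) (f i),
      forall i x, P i (f i x - s i x)
    & forall i x, diff D (f i.+1 x) = f i (bd F i x)].
Proof.
move=> P0.
pose Q i (f : {linear F i -> D}) (f' : {linear F i.+1 -> D}) :=
  forall x, diff D (f' x) = f (bd F i x).
have [||f [f0 fP]] := @dependent_sequence _ partial_lift Q (s 0%N).
- by split=> [|x|x]; [exact: s_homogeneous | rewrite subrr | exact: s_class].
- exact: partial_lift_step.
exists f; split=> // i; first by have [[]] := fP i.
  by have [[_ h _] _] := fP i.
by have [_] := fP i.
Qed.

End Obstruction.

(** * The module underlying folds and free flags *)

Section FoldModule.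
Variables (S : gradedRing) (a : int) (F : grComplex S).
Local Notation X := (fold_mod a F).

(** Twisting does not change the underlying module, so coordinates are read in [F i] itself; the
    shift of degrees reappears in [gr_fold_coord]. *)
Definition fold_coord i (x : X) : F i := dsum_coord i x.
Arguments fold_coord : simpl never.
Lemma fold_coord_linear i : linear (fold_coord i). Proof. by []. Qed.
HB.instance Definition _ i :=
  GRing.isLinear.Build S X (F i) *:%R (fold_coord i) (fold_coord_linear i).

Lemma fold_ext x y : (forall i, fold_coord i x = fold_coord i y) -> x = y.
Proof. exact: dsumP. Qed.

Lemma fold_inj_exists i : exists f : {linear F i -> X},
  (forall y, fold_coord i (f y) = y) /\
  forall j y, j != i -> fold_coord j (f y) = 0.
Proof.
have /choice[f fE] (y : F i) : exists x : X,
    fold_coord i x = y /\ forall j, j <> i -> fold_coord j x = 0.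
  exact: (@dsum_inj_ex S (fun i => twist (F i) (a *+ i)) i y).
have [c x y|g gE] := @linear_exists _ _ X f.
  apply: fold_ext => j; rewrite (linearP (fold_coord j)) /=.
  have [f1 f10] := fE (c *: x + y); have [f2 f20] := fE x; have [f3 f30] := fE y.
  have [->|/eqP ji] := eqVneq j i; first by rewrite f1 f2 f3.
  by rewrite f10 // f20 // f30 // scaler0 addr0.
exists g; split=> [y|j y /eqP ji]; rewrite gE; first by have [] := fE y.
by have [_] := fE y; exact.
Qed.

Definition fold_inj i : {linear F i -> X} := projT1 (cid (fold_inj_exists i)).

Lemma fold_coord_inj i y : fold_coord i (fold_inj i y) = y.
Proof. by rewrite /fold_inj; case: cid => f []. Qed.

Lemma fold_coord_inj0 i j y : j != i -> fold_coord j (fold_inj i y) = 0.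
Proof. by move=> ji; rewrite /fold_inj; case: cid => f /= [_]; apply. Qed.

(** The flag filtration: its m-th step is the sum of [F 0], ..., [F (m-1)]. *)
Definition supported_below m (x : X) : Prop :=
  forall k, (m <= k)%N -> fold_coord k x = 0.

Lemma supported_below_ex x : exists m, supported_below m x.
Proof. exact: dsum_finsupp. Qed.

Lemma supported_below_le m n x :
  (m <= n)%N -> supported_below m x -> supported_below n x.
Proof. by move=> mn xm k nk; apply: xm; exact: leq_trans nk. Qed.

Lemma supported_belowP m (c : S) x y : supported_below m x ->
  supported_below m y -> supported_below m (c *: x + y).
Proof. by move=> xm ym k mk; rewrite linearP /= xm // ym // scaler0 addr0. Qed.

Lemma supported_below0 m : supported_below m 0.
Proof. by move=> k _; rewrite linear0. Qed.

Lemma supported_below_inj i y : supported_below i.+1 (fold_inj i y).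
Proof. by move=> k ik; rewrite fold_coord_inj0 // gtn_eqF. Qed.

Lemma fold_decomp m x : supported_below m x ->
  x = \sum_(i < m) fold_inj i (fold_coord i x).
Proof.
move=> xm; apply: fold_ext => k; rewrite linear_sum /=.
have [mk|km] := leqP m k.
  rewrite xm // big1 // => i _; rewrite fold_coord_inj0 //.
  by rewrite gtn_eqF // (leq_trans (ltn_ord i)).
rewrite (bigD1 (Ordinal km)) //= fold_coord_inj big1 ?addr0 // => i ik.
by rewrite fold_coord_inj0 // eq_sym.
Qed.

Lemma fold_linear_ext (V : lmodType S) (f g : {linear X -> V}) :
  (forall i y, f (fold_inj i y) = g (fold_inj i y)) -> f =1 g.
Proof.
move=> fg x; have [m /fold_decomp ->] := supported_below_ex x.
by rewrite !linear_sum; apply: eq_bigr => i _; exact: fg.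
Qed.

Lemma fold_map_exists (V : lmodType S) (f : forall i, {linear F i -> V}) :
  exists g : {linear X -> V}, forall i y, g (fold_inj i y) = f i y.
Proof.
have /choice[N hN] := supported_below_ex.
pose h x := \sum_(i < N x) f i (fold_coord i x).
(* The value does not depend on the chosen bound [N x], so linearity can be checked with a common
   bound. *)
have hE m x : supported_below m x -> h x = \sum_(i < m) f i (fold_coord i x).
  have aux m1 m2 : supported_below m1 x -> supported_below m2 x -> (m1 <= m2)%N ->
      \sum_(i < m1) f i (fold_coord i x) = \sum_(i < m2) f i (fold_coord i x).
    move=> xm1 _ m12; rewrite -!(big_mkord predT (fun i => f i (fold_coord i x))).
    rewrite [RHS](big_cat_nat _ m12) //= [X in _ = _ + X]big1_seq ?addr0 //.
    by move=> i /andP[_]; rewrite mem_index_iota => /andP[m1i _]; rewrite xm1 // linear0.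
  by move=> xm; have [le|/ltnW le] := leqP (N x) m; [|symmetry]; exact: aux.
have [c x y|g gE] := @linear_exists _ X V h.
  pose m := maxn (N x) (N y).
  have xm : supported_below m x by apply: supported_below_le (hN x); exact: leq_maxl.
  have ym : supported_below m y by apply: supported_below_le (hN y); exact: leq_maxr.
  rewrite (hE _ _ (supported_belowP c xm ym)) (hE _ _ xm) (hE _ _ ym).
  rewrite scaler_sumr -big_split; apply: eq_bigr => i _.
  by rewrite (linearP (fold_coord i)) (linearP (f i)).
exists g => i y; rewrite gE (hE i.+1); last exact: supported_below_inj.
rewrite big_ord_recr big1 /= ?add0r ?fold_coord_inj // => j _.
by rewrite fold_coord_inj0 ?linear0 // ltn_eqF.
Qed.

Lemma gr_fold_coord j x i : gr X j x -> gr (F i) (a *+ i + j) (fold_coord i x).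
Proof. by move=> /(_ i). Qed.

Lemma fold_coord_gcomp i k x :
  fold_coord i (gcomp k x) = gcomp (a *+ i + k) (fold_coord i x).
Proof.
rewrite addrC; symmetry; apply: gcomp_map => j y yj.
by rewrite addrC; exact: gr_fold_coord.
Qed.

Lemma fold_inj_homogeneous i : homogeneous_map (- (a *+ i)) (fold_inj i).
Proof.
move=> k y yk j; have [->|ji] := eqVneq j i.
  have -> : dsum_coord i (fold_inj i y) = y by exact: fold_coord_inj.
  by rewrite /= addrC subrK.
have -> : dsum_coord j (fold_inj i y) = 0 by exact: fold_coord_inj0.
exact: dsd0 (gr_dec (F j)) _.
Qed.

Lemma supported_below_gcomp m k x :
  supported_below m x -> supported_below m (gcomp k x).
Proof. by move=> xm i mi; rewrite fold_coord_gcomp xm // /gcomp raddf0. Qed.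

Lemma fold_diff_inj0 y : diff (Fold a F) (fold_inj 0 y) = 0.
Proof.
apply: fold_ext => i; rewrite linear0 -(linear0 (bd F i)).
by congr (bd F i _); exact: fold_coord_inj0.
Qed.

Lemma fold_diff_inj i y :
  diff (Fold a F) (fold_inj i.+1 y) = fold_inj i (bd F i y).
Proof.
apply: fold_ext => j; have [->|ji] := eqVneq j i.
  by rewrite fold_coord_inj; congr (bd F i _); exact: fold_coord_inj.
rewrite fold_coord_inj0 // -(linear0 (bd F j)).
by congr (bd F j _); apply: fold_coord_inj0; rewrite eqSS.
Qed.

(** An element of degree j has i-th coordinate of degree j + ia, so maps of degree -ia assemble into
    a graded map; commutation is checked on summands. *)
Lemma Fold_morphism (D : diffModule S a) (f : forall i, {linear F i -> D}) :
  (forall i, homogeneous_map (- (a *+ i)) (f i)) ->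
  (forall y, diff D (f 0%N y) = 0) ->
  (forall i y, diff D (f i.+1 y) = f i (bd F i y)) ->
  exists g : diffMorphism (Fold a F) D, forall i y, g (fold_inj i y) = f i y.
Proof.
move=> f_gr df0 df; have [g gE] := fold_map_exists f.
have g_gr : @graded_map S (Fold a F) D g.
  move=> j x xj; have [m /fold_decomp ->] := supported_below_ex x.
  rewrite linear_sum /=; apply: (big_ind (gr D j)) => [|u w|i _].
  - exact: dsd0 (gr_dec D) _.
  - exact: dsdD (gr_dec D) _ _ _.
  rewrite gE; have := f_gr i _ _ (gr_fold_coord i xj).
  by rewrite [a *+ i + j]addrC addrK.
have g_comm x : g (diff (Fold a F) x) = diff D (g x).
  apply: (@fold_linear_ext _ (g \o diff (Fold a F)) (diff D \o g)) => -[|i] y /=.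
    by rewrite fold_diff_inj0 linear0 gE df0.
  by rewrite fold_diff_inj !gE df.
by exists (DiffMorphism g_gr g_comm).
Qed.

(** * Cycles and boundaries of a free flag *)

Section Flag.
Variable E : freeFlag a F.
Local Notation d := (flag_diff E).

Lemma flag_diff_supported m x : supported_below m.+1 x -> supported_below m (d x).
Proof.
move=> /fold_decomp -> k mk; rewrite !linear_sum big1 // => i _.
apply: (@flag_lower _ _ _ E i); last by rewrite (leq_trans _ mk) // -ltnS.
by move=> j /eqP ji; exact: fold_coord_inj0.
Qed.

(** Without its top summand, [x] lies one filtration step lower and contributes nothing to
    coordinate m; on the top summand the anchor condition applies. *)
Lemma flag_diff_top m x : supported_below m.+2 x ->
  fold_coord m (d x) = bd F m (fold_coord m.+1 x).
Proof.
move=> xm; pose y := fold_inj m.+1 (fold_coord m.+1 x).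
have -> : x = (x - y) + y by rewrite subrK.
have xy : supported_below m.+1 (x - y).
  move=> k; rewrite leq_eqVlt linearB /= => /orP[/eqP <-|mk].
    by rewrite fold_coord_inj subrr.
  by rewrite xm // supported_below_inj // subrr.
move: (x - y) xy => u su.
rewrite (linearD d) (linearD (fold_coord m)) (linearD (fold_coord m.+1)) /=.
rewrite (flag_diff_supported su) // (su m.+1) // !add0r.
by apply: (@flag_anchor _ _ _ E m) => k /eqP km; exact: fold_coord_inj0.
Qed.

Lemma flag_diff_inj0 y : d (fold_inj 0 y) = 0.
Proof.
apply: fold_ext => k; rewrite linear0.
by apply: (@flag_diff_supported 0) => //; exact: supported_below_inj.
Qed.

Lemma flag_diff_inj1 y : d (fold_inj 1 y) = fold_inj 0 (bd F 0 y).
Proof.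
have s1 := @supported_below_inj 1 y.
apply: fold_ext => -[|k]; first by rewrite flag_diff_top // !fold_coord_inj.
by rewrite (flag_diff_supported s1) // fold_coord_inj0.
Qed.

Hypothesis F_exact : forall i x, bd F i x = 0 -> exists y, x = bd F i.+1 y.

(** The top coordinate of a cycle is a cycle of [F], hence a boundary by exactness; subtracting the
    differential of a lift one summand higher lowers the support, until only [F 0] remains. The
    bound on [y] controls later corrections. *)
Lemma flag_cycle_reduce m z : supported_below m z -> d z = 0 ->
  exists x y, supported_below m.+1 y /\ z = fold_inj 0 x + d y.
Proof.
elim: m z => [|[|m] IH] z zm dz.
- exists 0, 0; split; first exact: supported_below0.
  by rewrite !linear0 addr0; apply: fold_ext => k; rewrite linear0 zm.
- exists (fold_coord 0 z), 0; split; first exact: supported_below0.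
  by rewrite linear0 addr0 {1}(fold_decomp zm) big_ord1.
have [|y zy] := F_exact (i := m) (x := fold_coord m.+1 z).
  by rewrite -flag_diff_top // dz linear0.
pose y' := fold_inj m.+2 y.
have sy : supported_below m.+3 y' by exact: supported_below_inj.
have [||x [w [sw zw]]] := IH (z - d y').
- move=> k; rewrite leq_eqVlt linearB /= => /orP[/eqP <-|mk].
    by rewrite flag_diff_top // fold_coord_inj -zy subrr.
  by rewrite zm // (flag_diff_supported sy) // subrr.
- by rewrite linearB /= dz flag_sq subrr.
exists x, (w + y'); split.
  rewrite -[w]scale1r; apply: supported_belowP => //.
  exact: supported_below_le sw.
by rewrite linearD addrA -zw subrK.
Qed.

(** The same reduction applied to [y]: boundaries are subtracted until only [F 0] and [F 1] are
    left. Together with [flag_cycle_reduce] this identifies the homology of a flag with the cokernel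
    of [bd F 0]. *)
Lemma flag_boundary_bottom x y : d y = fold_inj 0 x -> exists v, x = bd F 0 v.
Proof.
have [m0 sy0] := supported_below_ex y.
have {sy0} : supported_below m0.+2 y by apply: supported_below_le sy0; exact: leqW.
elim: m0 y => [|m IH] y sy dy.
  by exists (fold_coord 1 y); rewrite -flag_diff_top // dy fold_coord_inj.
have [|w yw] := F_exact (i := m.+1) (x := fold_coord m.+2 y).
  by rewrite -flag_diff_top // dy fold_coord_inj0.
pose w' := fold_inj m.+3 w.
have sw : supported_below m.+4 w' by exact: supported_below_inj.
apply: (IH (y - d w')).
- move=> k; rewrite leq_eqVlt linearB /= => /orP[/eqP <-|mk].
    by rewrite flag_diff_top // fold_coord_inj -yw subrr.
  by rewrite sy // (flag_diff_supported sw) // subrr.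
- by rewrite linearB /= dy flag_sq subr0.
Qed.

End Flag.

Lemma fold_diff_lower i (x : X) : (forall k, k <> i -> dsum_coord k x = 0) ->
  forall j, (i <= j)%N -> dsum_coord j (fold_fun x) = 0.
Proof.
move=> xi j ij; rewrite -(linear0 (bd F j)); congr (bd F j _); apply: xi.
by move=> ji; rewrite -ji ltnn in ij.
Qed.

(** Makes the results on flags available for the fold. *)
Definition Fold_flag : freeFlag a F :=
  @FreeFlag S a F (@fold_fun S a F) (@fold_graded S a F) (@fold_sq S a F)
    fold_diff_lower (fun _ _ _ => erefl).

End FoldModule.

Lemma bijective_of_inj_surj (U V : Type) (f : U -> V) :
  injective f -> (forall v, exists u, f u = v) -> bijective f.
Proof. by move=> f_inj /choice[g gK]; exists g => // x; apply: f_inj; rewrite gK. Qed.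

(** * Classes of cycles, read in [M] *)

Section HomologyClass.
Variables (S : gradedRing) (a : int) (M : grModule S) (D : diffModule S a).
Variable phi : {linear dhomology D -> M}.
Hypothesis phi_gr : graded_map phi.

Definition has_class (z : D) (m : M) : Prop :=
  exists2 z' : ker_type (diff D), ker_val _ z' = z & phi (hclass _ _ z') = m.

Lemma has_class_linear (c : S) z m z' m' :
  has_class z m -> has_class z' m' -> has_class (c *: z + z') (c *: m + m').
Proof.
move=> [w <- <-] [w' <- <-]; exists (c *: w + w'); first exact: ker_val_linear.
by rewrite (linearP (hclass (diff D) (diff D))) (linearP phi).
Qed.

Lemma has_class_cycle z m : has_class z m -> diff D z = 0.
Proof. by move=> [w <- _]; exact: ker_valP. Qed.

Lemma has_class_total z : diff D z = 0 -> exists m, has_class z m.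
Proof. by move=> dz; eexists; exists (ker_mk dz). Qed.

Lemma has_class_unique z m m' : has_class z m -> has_class z m' -> m = m'.
Proof. by move=> [w <- <-] [w' /ker_val_inj -> <-]. Qed.

Lemma has_class_boundary y : has_class (diff D y) 0.
Proof.
exists (ker_mk (diff_sq y)) => //; rewrite -(linear0 phi); congr (phi _).
rewrite -[RHS](linear0 (hclass (diff D) (diff D))); apply/hclass_eq.
by exists y; rewrite (linear0 (ker_val (diff D))) subr0.
Qed.

Lemma has_class_homogeneous k z m : gr D k z -> has_class z m -> gr M k m.
Proof. by move=> zk [w wz <-]; apply: phi_gr; exists w; rewrite ?wz. Qed.

(** The components of a cycle are cycles. Their classes are homogeneous of the matching degrees and
    add up to [m], so they are the components of [m]. *)
Lemma has_class_comp k z m : has_class z m -> has_class (gcomp k z) (gcomp k m).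
Proof.
move=> zm; have dz := has_class_cycle zm.
have /choice[n nE] j : exists m', has_class (gcomp j z) m'.
  apply: has_class_total; rewrite -(gcomp_map j z (@diff_homogeneous S a D)) dz.
  by rewrite /gcomp raddf0.
have class0 : has_class 0 0 by have := has_class_boundary 0; rewrite linear0.
have [s us [c0 ez]] := comp_sum (gr_dec D) z.
suff -> : gcomp k m = n k by exact: nE.
apply: (comp_unique (gr_dec M) us) => [j|j js|].
- exact: has_class_homogeneous (gcomp_gr j z) (nE j).
- by apply: has_class_unique (nE j) _; rewrite /gcomp c0.
apply: has_class_unique zm _; rewrite {1}ez; apply: (big_rec2 has_class) => // j u w _ uw.
by have := has_class_linear 1 (nE j) uw; rewrite !scale1r.
Qed.

Lemma has_class0_boundary z : injective phi -> has_class z 0 -> exists y, diff D y = z.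
Proof.
move=> phi_inj [w <-]; rewrite -(linear0 phi) => /phi_inj.
rewrite -[RHS](linear0 (hclass (diff D) (diff D))) => /hclass_eq[y].
by rewrite (linear0 (ker_val (diff D))) subr0 => ->; exists y.
Qed.

End HomologyClass.

(** * Quasi-isomorphism with the fold, and rigidity of flags *)

Section Rigidity.
Variables (S : gradedRing) (a : int) (M : grModule S) (F : grComplex S).
Hypothesis F_resolution : free_resolution F M.
Hypothesis Ext_vanishing : forall i : nat, (2 <= i)%N -> le_pdim i M ->
  forall q : Ext F M i, Ext_gr (a - a *+ i) q -> q = 0.

Lemma Fold_quasi_isomorphic (D : diffModule S a) :
  gr_iso (dhomology D) M -> exists g : diffMorphism (Fold a F) D, quasi_iso g.
Proof.
have cocycles := fun i z => cocycle_is_coboundary F_resolution (z := z) (i := i) Ext_vanishing.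
have [F_free [eps [eps_gr eps_surj exF0 exF]]] := F_resolution.
move=> [phi [psi [phi_gr psi_gr phiK psiK]]].
pose K := has_class phi.
have K_surj m : exists z, K z m.
  have [z zE] := hclass_surj (psi m); exists (ker_val _ z), z => //.
  by rewrite zE psiK.
have [|k x xk|s0 s0_gr s0K] :=
    @gr_free_lift _ _ D (- (a *+ 0)) (fun x y => K y (eps x)) (F_free 0%N).
- by move=> c x y x' y' h h'; rewrite linearP; exact: has_class_linear.
- have [z Kz] := K_surj (eps x); exists (gcomp (k - a *+ 0) z); first exact: gcomp_gr.
  rewrite mulr0n subr0; have := has_class_comp phi_gr k Kz.
  by rewrite [gcomp k (eps x)]comp_id //; exact: eps_gr.
(* Deviations are unrestricted here, so only the value in degree 0 matters: it lifts [eps] to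
   cycles. *)
pose s i : {linear F i -> D} :=
  if i is 0 return {linear F i -> D} then s0 else \0.
have [||||||||f [f0 f_gr _ df]] := @lift_exists _ a M F F_free cocycles D K
   (@has_class_linear _ _ _ _ phi) (@has_class_cycle _ _ _ _ phi) (@has_class_total _ _ _ _ phi)
   (@has_class_unique _ _ _ _ phi) (@has_class_boundary _ _ _ _ phi)
   (has_class_comp phi_gr) (fun _ _ => True) _ _ _ _ s.
- by [].
- by [].
- by move=> i z _ /(has_class0_boundary (can_inj phiK))[y]; exists y.
- by move=> i m; have [z] := K_surj m; exists z.
- by case=> [|i] // k x _ /=; exact: dsd0 (gr_dec D) _.
- by [].
- by move=> x; have := s0K (bd F 0 x); have /exF0 -> : exists y, bd F 0 x = bd F 0 y by exists x.
- by [].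
have K0 y : K (f 0%N y) (eps y) by rewrite f0; exact: s0K.
have [|g gE] := Fold_morphism f_gr _ df.
  by move=> y; exact: has_class_cycle (K0 y).
exists g; apply: bijective_of_inj_surj => [q q'|q].
- have [z <-] := hclass_surj q; have [z' <-] := hclass_surj q'.
  rewrite !dhomology_mapE => /hclass_eq[u /= gu]; apply/hclass_eq.
  rewrite -linearB in gu; rewrite -(linearB (ker_val _)) in gu *.
  move: (z - z') gu => w gu.
  have [m wm] := supported_below_ex (ker_val _ w).
  (* Injectivity: modulo boundaries the cycle [w] lies in [F 0], where [g] has class [eps x]; as
     [g w] is a boundary, [x] lies in the image of [bd F 0]. *)
  have [x [y [_ wE]]] := flag_cycle_reduce (E := Fold_flag a F) (fun i x => proj1 (exF i x)) wm (ker_valP w).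
  have /exF0[v xv] : eps x = 0.
    apply: has_class_unique (K0 x) _; rewrite -gE.
    have -> : fold_inj a F 0 x = ker_val _ w - diff (Fold a F) y by rewrite wE addrK.
    rewrite linearB /= dfun_comm gu -linearB; exact: has_class_boundary.
  exists (fold_inj a F 1 v + y).
  by rewrite linearD /= fold_diff_inj -xv wE.
(* Surjectivity: if [eps x] is the class of [z], then [f 0 x] and [z] differ by a boundary. *)
have [z <-] := hclass_surj q; have [m Km] := has_class_total phi (ker_valP z).
have [x xm] := eps_surj m.
pose z' : ker_type (diff (Fold a F)) := ker_mk (fold_diff_inj0 a x).
exists (hclass _ _ z'); rewrite dhomology_mapE; apply/hclass_eq => /=.
have [|y dy] := @has_class0_boundary _ _ _ _ phi (f 0%N x - ker_val _ z) (can_inj phiK).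
  have := has_class_linear (-1) Km (K0 x).
  by rewrite !scaleN1r addrC xm addNr.
by exists y; rewrite gE.
Qed.

Lemma flag_isomorphic_Fold (E : freeFlag a F) :
  diff_isomorphic (flag_module E) (Fold a F).
Proof.
have cocycles := fun i z => cocycle_is_coboundary F_resolution (z := z) (i := i) Ext_vanishing.
have [F_free [eps [eps_gr eps_surj exF0 exF']]] := F_resolution.
have exF i x := proj1 (exF' i x).
pose inj := fold_inj a F.
pose D := flag_module E.
(* The class is read off the normal form of [flag_cycle_reduce]; [flag_boundary_bottom] makes it
   well defined. *)
pose K (z : D) m := exists x y, z = inj 0%N x + diff D y /\ eps x = m.
have K_unique z m m' : K z m -> K z m' -> m = m'.
  move=> [x [y [-> <-]]] [x' [y' [e <-]]].
  have [|v xv] := flag_boundary_bottom (E := E) exF (y := y' - y) (x := x - x').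
    rewrite !linearB /=; apply/eqP; rewrite subr_eq addrAC eq_sym subr_eq [eqbRHS]addrC; exact/eqP.
  apply/eqP; rewrite -subr_eq0 -linearB; apply/eqP/exF0; by exists v.
have [||||||||||||||f [f0 f_gr fP df]] := @lift_exists _ a M F F_free cocycles D K
   _ _ _ _ _ _ (@supported_below S a F) _ _ _ _ inj.
- move=> c z m z' m' [x [y [-> <-]]] [x' [y' [-> <-]]].
  exists (c *: x + x'), (c *: y + y'); split; last by rewrite linearP.
  by rewrite !linearP /= scalerDr addrACA.
- by move=> z m [x [y [-> _]]]; rewrite linearD diff_sq addr0; exact: flag_diff_inj0.
- move=> z dz; have [m zm] := supported_below_ex z.
  by have [x [y [_ ->]]] := flag_cycle_reduce exF zm dz; exists (eps x), x, y.
- exact: K_unique.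
- by move=> y; exists 0, y; rewrite !linear0 add0r.
- move=> k z m [x [y [-> <-]]]; exists (gcomp k x), (gcomp (k - a) y); split; last first.
    by rewrite -(gcomp_map (e := 0) k x) ?addr0 // => j u uj; rewrite addr0; exact: eps_gr.
  rewrite /gcomp raddfD -/(gcomp _ _) -/(gcomp _ _); congr (_ + _).
    have := gcomp_map k x (@fold_inj_homogeneous S a F 0%N).
    by rewrite mulr0n oppr0 addr0.
  have := gcomp_map (k - a) y (@diff_homogeneous S a D).
  by rewrite subrK.
- exact: supported_belowP.
- exact: supported_below_gcomp.
- move=> i z zi Kz.
  have dz : diff D z = 0.
    by have [x [y [-> _]]] := Kz; rewrite linearD diff_sq addr0; exact: flag_diff_inj0.
  have [x [y [yi zE]]] := flag_cycle_reduce exF zi dz.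
  have /exF0[v xv] : eps x = 0 by apply: K_unique Kz; exists x, y.
  (* The correction [inj 1 v] has support below 2, which is allowed only for positive [i]; for
     [i = 0] the element [z] is itself zero. *)
  case: i => [|i] in zi yi *.
    exists 0; first exact: supported_below0.
    by rewrite linear0; apply: fold_ext => k; rewrite linear0 zi.
  exists (inj 1%N v + y); last by rewrite linearD [diff D (inj 1%N v)]flag_diff_inj1 -xv.
  rewrite -[inj 1%N v]scale1r; apply: supported_belowP => //.
  exact: supported_below_le (supported_below_inj _ _).
- move=> i m; have [x <-] := eps_surj m; exists (inj 0%N x).
    exact: supported_below_le (supported_below_inj _ _).
  by exists x, 0; rewrite linear0 addr0.
- exact: fold_inj_homogeneous.
(* The inclusions commute with the differentials modulo lower summands: coordinate [i] agrees by the
   anchor, and the higher ones vanish on both sides. *)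
- move=> i x k ik.
  have s1 := @supported_below_inj S a F i.+1 x.
  rewrite linearB /= [fold_coord k (diff D _)](_ : _ = fold_coord k (inj i (bd F i x))) ?subrr //.
  move: ik; rewrite leq_eqVlt => /orP[/eqP <-|ik].
    by rewrite [LHS](flag_diff_top E s1) !fold_coord_inj.
  by rewrite [LHS](flag_diff_supported E s1) // fold_coord_inj0 // gtn_eqF.
- move=> x; exists (bd F 0 x), 0; rewrite linear0 addr0; split=> //.
  by apply/exF0; exists x.
- exact: supported_below0.
have [|g gE] := Fold_morphism f_gr _ df.
  by move=> y; rewrite f0; exact: flag_diff_inj0.
(* Unipotence: [g] minus the identity lowers the filtration, which gives bijectivity by induction on
   the support. *)
have g_lower m x : supported_below m.+1 x -> supported_below m (g x - x).
  move=> xm k mk.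
  have -> : g x - x = \sum_(i < m.+1) (g (inj i (fold_coord i x)) - inj i (fold_coord i x)).
    by rewrite sumrB -linear_sum -(fold_decomp xm).
  rewrite linear_sum big1 // => i _; rewrite linearB /=.
  have := fP i (fold_coord i x) k; rewrite linearB /= -gE; apply.
  by rewrite (leq_trans _ mk) // -ltnS.
have g_inj : injective g.
  suff g0 m x : supported_below m x -> g x = 0 -> x = 0.
    move=> x y gxy; have [m xm] := supported_below_ex (x - y).
    apply/eqP; rewrite -subr_eq0; apply/eqP/(g0 m) => //.
    by rewrite linearB /= gxy subrr.
  elim: m x => [|m IH] x xm gx0.
    by apply: fold_ext => k; rewrite linear0 xm.
  apply: IH => // k mk; have := g_lower m x xm k mk.
  by rewrite gx0 sub0r linearN => /eqP; rewrite oppr_eq0 => /eqP.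
have g_surj z : exists x, g x = z.
  have [m zm] := supported_below_ex z; elim: m z zm => [|m IH] z zm.
    exists 0; rewrite linear0; apply: fold_ext => k; by rewrite linear0 zm.
  (* The preimage [x] of [g z - z] corrects [z] to the preimage [z - x]. *)
  have [x gx] := IH _ (g_lower m z zm).
  by exists (z - x); rewrite linearB /= gx opprB addrC subrK.
have /choice[h hK] := g_surj.
have gK : cancel g h by move=> x; apply: g_inj; rewrite hK.
have [c x y|h' h'E] := @linear_exists _ D (Fold a F) h.
  by apply: g_inj; rewrite linearP !hK.
have h'_gr : graded_map h'.
  move=> j z zj; rewrite h'E; have := gcomp_map (e := 0) j (h z) (f := g).
  rewrite hK addr0 => e.
  (* Both sides have image [z] under the injective graded map [g]. *)
  suff -> : h z = gcomp j (h z) by exact: gcomp_gr.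
  apply: g_inj; rewrite hK -e /gcomp ?comp_id // => k x xk.
  by rewrite addr0; exact: dfun_graded.
have h'_comm x : h' (diff D x) = diff (Fold a F) (h' x).
  by apply: g_inj; rewrite dfun_comm !h'E !hK.
exists (DiffMorphism h'_gr h'_comm), g; split=> x /=; rewrite h'E //.
Qed.
End Rigidity.

Theorem corollary1p7
    (S : gradedRing) (m0 : idealr (deg0_ring S)) (a : int)
    (M : grModule S) (F : grComplex S)
    (S_noetherian : noetherian S)
    (S0_local : local_ring m0)
    (k_closed : GRing.closed_field_axiom (Quotient.quot m0))
    (M_fin_gen : fin_gen M)
    (F_resolution : free_resolution F M)
    (F_minimal : minimal m0 F)
    (Ext_vanishing : forall i : nat, (2 <= i)%N -> le_pdim i M ->
       forall q : Ext F M i, Ext_gr (a - a *+ i) q -> q = 0) :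
  (forall D : diffModule S a,
     gr_iso (dhomology D) M -> quasi_isomorphic D (Fold a F)) /\
  rigid_module a M.
Proof.
have [F_free _] := F_resolution; split=> [D HD|].
  have [g g_qi] := Fold_quasi_isomorphic F_resolution Ext_vanishing HD.
  by apply: rst_sym; apply: rst_step; exists g.
exists F => //; split=> // E.
exact: flag_isomorphic_Fold F_resolution Ext_vanishing E.
Qed.
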